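(* Let $\Sigma \subset \mathbb{R}^d$ ($d \ge 2$) be a bounded, smooth $(d-1)$-manifold without boundary. Consider two points $p, q \in \Sigma$ and let $\delta = |pq| / \mathrm{lfs}(p)$. Let $n_p$ and $n_q$ be outward-directed vectors normal to $\Sigma$ at $p$ and $q$, respectively. If $\delta < \sqrt{4\sqrt{5} - 8}$ $(\approx 0.9717)$, then $\angle(n_p, n_q) \leq \eta_1(\delta)$ where $$\eta_1(\delta) = \arccos\left( 1 - \frac{\delta^2}{2\sqrt{1-\delta^2}} \right) = \delta + \frac{7}{24}\delta^3 + \frac{123}{640}\delta^5 + \frac{1083}{7168}\delta^7 + O(\delta^9) \quad (\delta \to 0).$$ Moreover, if $\delta_N$ is the distance from $q$ to the tangent space $T_p\Sigma$ divided by $\mathrm{lfs}(p)$, we have the bound (which is stronger when $\delta_N \neq 0$) $$\angle(n_p, n_q) \leq \arccos\left( 1 - \frac{\delta^2 - \delta^4/2 - 2\delta_N^2}{\sqrt{(1-\delta^2)\left( (2-\delta^2)^2 - 4\delta_N^2 \right)}} \right).$$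
   Context: A bounded smooth manifold without boundary in $\mathbb{R}^d$ means a compact smoothly embedded submanifold without boundary. $T_p\Sigma$ is the tangent hyperplane (flat through $p$) at $p$. The medial axis $M$ of $\Sigma$ is the closure of the set of points of $\mathbb{R}^d$ having more than one nearest point on $\Sigma$; the local feature size is $\mathrm{lfs}(p) = \min_{m \in M}|pm|$. A $(d-1)$-manifold without boundary divides $\mathbb{R}^d$ into an unbounded outside region and bounded inside; the outward normal at $p$ points into the unbounded side (if $\Sigma$ is disconnected: the unbounded component of the complement of the connected component of $\Sigma$ containing $p$). $\angle(n_p,n_q) \in [0^\circ,180^\circ]$ is the usual angle between vectors. *)

(* Defs.v *)
From HB Require Import structures.
From mathcomp Require Import all_boot all_order all_algebra.
From mathcomp Require Import all_classical all_reals all_analysis.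
Set Implicit Arguments.
Unset Strict Implicit.
Unset Printing Implicit Defensive.
Import Order.TTheory GRing.Theory Num.Theory.
Import numFieldNormedType.Exports.
Local Open Scope classical_set_scope.
Local Open Scope ring_scope.

(* The norm that the library puts on 'rV[R]_d is the sup norm. It induces the
   usual topology, and is used here only through notions that are the same for
   all norms on R^d (open, closed, compact, bounded, differentiable); lengths
   and angles are taken in the Euclidean structure given by dotp and enorm. *)
Definition dotp (R : realType) (d : nat) (u v : 'rV[R]_d) : R :=
  \sum_(i < d) u 0 i * v 0 i.

Definition enorm (R : realType) (d : nat) (u : 'rV[R]_d) : R :=
  Num.sqrt (dotp u u).

Definition dist (R : realType) (d : nat) (x y : 'rV[R]_d) : R := enorm (x - y).

Definition distset (R : realType) (d : nat) (x : 'rV[R]_d) (A : set 'rV[R]_d)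
    : R :=
  inf [set dist x a | a in A].

(* In radians; meant for nonzero u and v. *)
Definition angle (R : realType) (d : nat) (u v : 'rV[R]_d) : R :=
  acos (dotp u v / (enorm u * enorm v)).

(* f is of class C^k on U, meant for U open. *)
Fixpoint Ck_on (R : realType) (m n k : nat) (U : set 'rV[R]_m)
    (f : 'rV[R]_m -> 'rV[R]_n) : Prop :=
  match k with
  | 0 => forall x, U x -> {for x, continuous f}
  | k'.+1 => (forall x, U x -> differentiable f x) /\
             (forall v : 'rV[R]_m, Ck_on k' U (fun x => 'D_v f x))
  end.

Definition smooth_on (R : realType) (m n : nat) (U : set 'rV[R]_m)
    (f : 'rV[R]_m -> 'rV[R]_n) : Prop :=
  forall k, Ck_on k U f.

(* phi is a diffeomorphism from the open set U onto the open set V, with inverse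
   psi. *)
Definition diffeo (R : realType) (d : nat) (U V : set 'rV[R]_d)
    (phi psi : 'rV[R]_d -> 'rV[R]_d) : Prop :=
  [/\ open U, open V, smooth_on U phi & smooth_on V psi] /\
  (forall x, U x -> V (phi x) /\ psi (phi x) = x) /\
  (forall y, V y -> U (psi y) /\ phi (psi y) = y).

(* Embedded k-dimensional submanifold without boundary, by slice charts: locally
   S is straightened to R^k x {0}. *)
Definition submanifold (R : realType) (d k : nat) (S : set 'rV[R]_d) : Prop :=
  forall p, S p -> exists U V phi psi,
    [/\ @diffeo R d U V phi psi, U p &
        forall x, U x ->
          (S x <-> forall i : 'I_d, (k <= i)%N -> phi x 0 i = 0)].

Definition tangent_vector (R : realType) (d : nat) (S : set 'rV[R]_d)
    (p v : 'rV[R]_d) : Prop :=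
  exists gamma : R -> 'rV[R]_d,
    [/\ gamma 0 = p, \forall t \near (0 : R), S (gamma t) &
        is_derive (0 : R) 1 gamma v].

(* The tangent space as a flat through p. *)
Definition tangent_space (R : realType) (d : nat) (S : set 'rV[R]_d)
    (p : 'rV[R]_d) : set 'rV[R]_d :=
  [set p + v | v in tangent_vector S p].

Definition nearest (R : realType) (d : nat) (S : set 'rV[R]_d)
    (x a : 'rV[R]_d) : Prop :=
  S a /\ forall b, S b -> dist x a <= dist x b.

Definition medial_axis (R : realType) (d : nat) (S : set 'rV[R]_d)
    : set 'rV[R]_d :=
  closure [set x | exists a b, [/\ nearest S x a, nearest S x b & a != b]].

(* The infimum is attained, the medial axis being closed; for S compact, nonempty
   and of codimension 1 the medial axis is nonempty. *)
Definition lfs (R : realType) (d : nat) (S : set 'rV[R]_d) (p : 'rV[R]_d) : R :=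
  distset p (medial_axis S).

(* Union of the unbounded connected components of the complement of C; for C
   compact in dimension at least 2 there is exactly one. *)
Definition outside (R : realType) (d : nat) (C : set 'rV[R]_d)
    : set 'rV[R]_d :=
  [set x | ~ bounded_set (connected_component (~` C) x)].

(* n need not be a unit vector. *)
Definition outward_normal (R : realType) (d : nat) (S : set 'rV[R]_d)
    (p n : 'rV[R]_d) : Prop :=
  [/\ n != 0,
      forall v, tangent_vector S p v -> dotp n v = 0 &
      \forall t \near (0 : R)^'+, outside (connected_component S p) (p + t *: n)].

Definition eta1 (R : realType) (delta : R) : R :=
  acos (1 - delta ^+ 2 / (2 * Num.sqrt (1 - delta ^+ 2))).

Definition eta1N (R : realType) (delta deltaN : R) : R :=
  acos (1 - (delta ^+ 2 - delta ^+ 4 / 2 - 2 * deltaN ^+ 2) /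
            Num.sqrt ((1 - delta ^+ 2) *
                      ((2 - delta ^+ 2) ^+ 2 - 4 * deltaN ^+ 2))).

(* Main.v *)
(* Scale so that lfs(p) = 1. Balls of radius 1 tangent to Sigma at p on either
   side miss Sigma, since a tangent ball can grow as long as its center stays off
   the medial axis; likewise the tangent balls at q can grow until their centers
   leave the unit ball around p, so that their radii r_i (inside) and r_o
   (outside) satisfy r_i r_o = 1 - delta^2. A ball outside Sigma at one point is
   disjoint from a ball inside Sigma at the other, and the two resulting
   inequalities between centers bound the angle.
   That the two sides of Sigma at a point are not both outside is the
   Jordan-Brouwer separation theorem; it is proved by continuing along rays a
   locally defined two-valued side function, constant off the surface and
   flipping across it. *)
Require Import Defs.
From HB Require Import structures.
From mathcomp Require Import all_boot all_order all_algebra.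
From mathcomp Require Import all_classical all_reals all_analysis.
From mathcomp Require Import ring lra.
Import Order.TTheory GRing.Theory Num.Theory.
Import numFieldNormedType.Exports.
Set Implicit Arguments.
Unset Strict Implicit.
Unset Printing Implicit Defensive.
Local Open Scope classical_set_scope.
Local Open Scope ring_scope.

(** * Euclidean structure *)

Section Euclid.
Variables (R : realType) (d : nat).
Local Notation V := 'rV[R]_d.
Implicit Types (u v w x y z n : V) (a b : R).

(** The product of the two radii is the power of [q] with respect to the ball around [p]: they are
    the distances from [q] at which its normal line leaves that ball. One degree of freedom is left,
    and the bound is its value at the configuration where both disjointness inequalities are
    equalities. That tangent balls start with a positive radius, and that [p] is off the medial
    axis, both come from one second-order estimate of the surface against its tangent planes,
    uniform in the base points near [p]. The medial axis refers to all of [Sigma], but outside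
    refers to one component. The balls therefore avoid the whole of [Sigma], the separation theorem
    is applied to the component alone, and [p] and [q] must first be shown to share it. For the
    expansion, [eta1] itself is transcendental but its derivative is algebraic: clearing its two
    square roots reduces the comparison with a polynomial to a polynomial identity, and the mean
    value theorem integrates the error. *)

Lemma dotpC u v : dotp u v = dotp v u.
Proof. by apply: eq_bigr => i _; rewrite mulrC. Qed.

Lemma dotpDl u v w : dotp (u + v) w = dotp u w + dotp v w.
Proof.
by rewrite /dotp -big_split; apply: eq_bigr => i _ /=; rewrite mxE mulrDl.
Qed.

Lemma dotpZl a u w : dotp (a *: u) w = a * dotp u w.
Proof. by rewrite /dotp big_distrr; apply: eq_bigr => i _ /=; rewrite mxE mulrA. Qed.

Lemma dotpDr u v w : dotp w (u + v) = dotp w u + dotp w v.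
Proof. by rewrite dotpC dotpDl !(dotpC w). Qed.

Lemma dotpZr a u w : dotp w (a *: u) = a * dotp w u.
Proof. by rewrite dotpC dotpZl dotpC. Qed.

Lemma dotpNl u w : dotp (- u) w = - dotp u w.
Proof. by rewrite -scaleN1r dotpZl mulN1r. Qed.

Lemma dotpNr u w : dotp w (- u) = - dotp w u.
Proof. by rewrite dotpC dotpNl dotpC. Qed.

Definition dotpE := (dotpDl, dotpDr, dotpNl, dotpNr, dotpZl, dotpZr).

Lemma dotp0r u : dotp u 0 = 0.
Proof. by rewrite -(scale0r u) dotpZr mul0r. Qed.

Lemma dotp_ge0 u : 0 <= dotp u u.
Proof. by apply: sumr_ge0 => i _; rewrite -expr2 sqr_ge0. Qed.

Lemma dotp_eq0 u : (dotp u u == 0) = (u == 0).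
Proof.
apply/idP/eqP => [|->]; last by rewrite dotp0r.
rewrite psumr_eq0 => [/allP h|i _]; last by rewrite -expr2 sqr_ge0.
apply/rowP => i; have := h i (mem_index_enum i).
by rewrite /= mulf_eq0 orbb mxE => /eqP.
Qed.

Lemma dotp_gt0 u : (0 < dotp u u) = (u != 0).
Proof. by rewrite lt_neqAle dotp_ge0 andbT eq_sym dotp_eq0. Qed.

Lemma enorm_ge0 u : 0 <= enorm u.
Proof. exact: sqrtr_ge0. Qed.

Lemma sqr_enorm u : enorm u ^+ 2 = dotp u u.
Proof. by rewrite sqr_sqrtr ?dotp_ge0. Qed.

Lemma enorm_gt0 u : (0 < enorm u) = (u != 0).
Proof. by rewrite sqrtr_gt0 dotp_gt0. Qed.

Lemma enorm_eq0 u : (enorm u == 0) = (u == 0).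
Proof. by have := enorm_gt0 u; rewrite lt_neqAle enorm_ge0 andbT eq_sym => /(congr1 negb); rewrite !negbK. Qed.

Lemma enorm0 : enorm (0 : V) = 0.
Proof. by apply/eqP; rewrite enorm_eq0. Qed.

Lemma enormN u : enorm (- u) = enorm u.
Proof. by rewrite /enorm !dotpE opprK. Qed.

Lemma enormZ a u : enorm (a *: u) = `|a| * enorm u.
Proof.
by rewrite /enorm !dotpE mulrA -expr2 sqrtrM ?sqr_ge0 // sqrtr_sqr.
Qed.

Lemma dotp_le_enorm u v : dotp u v <= enorm u * enorm v.
Proof.
have [->|u0] := eqVneq u 0; first by rewrite enorm0 mul0r dotpC dotp0r.
have := dotp_ge0 (dotp u u *: v - dotp u v *: u).
have u1 : 0 < dotp u u by rewrite dotp_gt0.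
rewrite !dotpE (dotpC v u) => h.
have h' : 0 <= dotp u u * dotp v v - dotp u v ^+ 2.
  rewrite -(pmulr_lge0 _ u1); apply: le_trans h _.
  rewrite le_eqVlt; apply/orP; left; apply/eqP; ring.
have [n0|n0] := leP (dotp u v) 0.
  by rewrite (le_trans n0) ?mulr_ge0 ?enorm_ge0.
have p0 : 0 <= enorm u * enorm v by rewrite mulr_ge0 ?enorm_ge0.
rewrite -(ler_pXn2r (n := 2)) ?nnegrE ?(ltW n0) //.
by rewrite exprMn !sqr_enorm -subr_ge0.
Qed.

Lemma normr_dotp_le u v : `|dotp u v| <= enorm u * enorm v.
Proof.
rewrite ler_norml dotp_le_enorm andbT lerNl -dotpNl.
by rewrite -(enormN u) dotp_le_enorm.
Qed.

Lemma ler_enormD u v : enorm (u + v) <= enorm u + enorm v.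
Proof.
rewrite -(ler_pXn2r (n := 2)) ?nnegrE ?addr_ge0 ?enorm_ge0 //.
rewrite sqrrD !sqr_enorm !dotpE (dotpC v u).
by have := dotp_le_enorm u v; lra.
Qed.

Lemma distC x y : dist x y = dist y x.
Proof. by rewrite /dist -enormN opprB. Qed.

Lemma dist_ge0 x y : 0 <= dist x y.
Proof. exact: enorm_ge0. Qed.

Lemma dist_triangle y x z : dist x z <= dist x y + dist y z.
Proof. by apply: le_trans (ler_enormD _ _); rewrite addrA subrK. Qed.

Lemma sqr_dist x y : dist x y ^+ 2 = dotp (x - y) (x - y).
Proof. exact: sqr_enorm. Qed.

Lemma distxx x : dist x x = 0.
Proof. by rewrite /dist subrr enorm0. Qed.

Lemma dist_eq0 x y : (dist x y == 0) = (x == y).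
Proof. by rewrite enorm_eq0 subr_eq0. Qed.

Lemma dist_gt0 x y : (0 < dist x y) = (x != y).
Proof. by rewrite enorm_gt0 subr_eq0. Qed.

Lemma normr_coord_le (u : V) i : `|u 0 i| <= `|u|.
Proof.
rewrite [leRHS]/Num.norm/= mx_normrE.
by apply: (le_trans _ (le_bigmax _ _ (0, i))).
Qed.

Lemma ler_norm_coord (u : V) (a : R) : 0 <= a -> (forall i, `|u 0 i| <= a) -> `|u| <= a.
Proof.
move=> a0 h; rewrite [leLHS]/Num.norm/= mx_normrE.
by apply: bigmax_le => // -[i j] _ /=; rewrite ord1.
Qed.

Lemma norm_le_enorm u : `|u| <= enorm u.
Proof.
apply: ler_norm_coord => [|i]; first exact: enorm_ge0.
rewrite -(ler_pXn2r (n := 2)) ?nnegrE ?enorm_ge0 // sqr_enorm real_normK ?num_real //.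
rewrite /dotp (bigD1 i) //= -expr2 lerDl sumr_ge0 // => j _.
by rewrite -expr2 sqr_ge0.
Qed.

(** The constant is crude; [d.+1] rather than [d] keeps it positive in dimension 0, so that it can
    be divided by. *)
Lemma enorm_le_norm u : enorm u <= d.+1%:R * `|u|.
Proof.
rewrite -(ler_pXn2r (n := 2)) ?nnegrE ?enorm_ge0 ?mulr_ge0 // sqr_enorm exprMn.
have : dotp u u <= \sum_(i < d) `|u| ^+ 2.
  apply: ler_sum => i _; rewrite -expr2 -[leLHS]real_normK ?num_real //.
  by rewrite lerXn2r ?nnegrE // normr_coord_le.
rewrite sumr_const card_ord -[X in _ <= X -> _]mulr_natl => /le_trans; apply.
rewrite ler_wpM2r ?sqr_ge0 // -natrX ler_nat.
by apply: (leq_trans (leqnSn d)); rewrite -mulnn leq_pmulr.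
Qed.

Lemma dist_nbhs x (e : R) : 0 < e -> nbhs x [set y | dist y x < e].
Proof.
move=> e0; have c0 : (0 : R) < d.+1%:R by rewrite ltr0n.
apply/nbhs_ballP; exists (e / d.+1%:R); first by rewrite /= divr_gt0.
move=> z; rewrite -ball_normE /ball_ /= distrC => hz.
apply: le_lt_trans (enorm_le_norm _) _.
by rewrite mulrC -ltr_pdivlMr.
Qed.

(** The Euclidean and sup norms being equivalent, Euclidean balls form a neighbourhood basis of the
    library's topology; the topological arguments below go through them. *)
Lemma nbhs_distP x (A : set V) :
  nbhs x A <-> exists2 e : R, 0 < e & forall y, dist y x < e -> A y.
Proof.
split=> [/nbhs_ballP[e /= e0 h]|[e e0 h]].
  exists e => // y hy; apply: h.
  rewrite -ball_normE /ball_ /= distrC; exact: le_lt_trans (norm_le_enorm _) hy.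
by apply: filterS (dist_nbhs x e0) => y /=; exact: h.
Qed.

Lemma lipschitz_dist_continuous (f : V -> R) (K : R) :
  (forall x y, f x - f y <= K * dist x y) -> continuous f.
Proof.
move=> h x.
have K0 : 0 < `|K| + 1 by rewrite ltr_wpDl.
have H (e : R) : 0 < e -> \forall z \near nbhs x, `|f x - f z| < e.
  move=> e0; have := dist_nbhs x (divr_gt0 e0 K0).
  apply: filterS => z /=; rewrite ltr_pdivlMr // => hz.
  have h1 := h x z; have h2 := h z x; rewrite distC in h1.
  have : `|f x - f z| <= K * dist z x by rewrite ler_norml; apply/andP; split; lra.
  move=> /le_lt_trans; apply; apply: le_lt_trans hz; rewrite mulrC ler_wpM2l ?dist_ge0 //.
  by rewrite (le_trans (ler_norm K)) // lerDl.
by move: H => /(@cvgrPdist_lt _ _ _ (nbhs x)).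
Qed.

Lemma dist_continuousl y : continuous (fun x => dist x y).
Proof.
apply: (@lipschitz_dist_continuous _ 1) => x z.
by rewrite mul1r lerBlDr dist_triangle.
Qed.

Lemma dotp_continuousl v : continuous (fun u => dotp u v).
Proof.
apply: (@lipschitz_dist_continuous _ (enorm v)) => x y.
by rewrite -dotpNl -dotpDl mulrC dotp_le_enorm.
Qed.

End Euclid.

(** * Nearest points and the medial axis *)

Section Nearest.
Variables (R : realType) (d : nat) (S : set 'rV[R]_d).
Local Notation V := 'rV[R]_d.
Implicit Types (u v w x y z n a b : V).
Hypothesis cS : compact S.

Lemma nearest_exists x : S !=set0 -> exists a, nearest S x a.
Proof.
move=> S0; have [|c] := @compact_EVT_min _ R (fun y => dist y x) S S0 cS.
  by apply: continuous_subspaceT; exact: dist_continuousl.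
rewrite inE => Sc h; exists c; split=> // b Sb.
by rewrite !(distC x); apply: h; rewrite inE.
Qed.

Lemma closed_dist_ge a (e : R) : closed [set b : V | e <= dist b a].
Proof.
apply: (@preimage_closed _ _ (fun b => dist b a) [set t | e <= t]).
  by move=> x _; exact: dist_continuousl.
exact: closed_ge.
Qed.

Lemma closed_dist_le a (e : R) : closed [set b : V | dist b a <= e].
Proof.
apply: (@preimage_closed _ _ (fun b => dist b a) [set t | t <= e]).
  by move=> x _; exact: dist_continuousl.
exact: closed_le.
Qed.

Lemma compact_dist_le a (e : R) : compact [set b : V | dist b a <= e].
Proof.
apply: bounded_closed_compact; last exact: closed_dist_le.
exists (e + `|a|); split; first by rewrite num_real.
move=> M hM b /= hb; apply: le_trans (ltW hM).
rewrite -[b](subrK a) (le_trans (ler_normD _ _)) // lerD2r.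
exact: le_trans (norm_le_enorm _) hb.
Qed.

(** The points of [S] at distance at least [e] from [a] form a compact set whose distance to [x]
    strictly exceeds [dist x a]. Moving [x] by less than half that gap cannot make one of them
    nearest. *)
Lemma nearest_continuous x a (e : R) :
  (forall b, nearest S x b -> b = a) -> 0 < e ->
  exists2 r : R, 0 < r &
    forall x' a', dist x' x < r -> nearest S x' a' -> dist a' a < e.
Proof.
move=> ua e0; set K := S `&` [set b : V | e <= dist b a].
have cK : compact K by apply: compact_closedI => //; exact: closed_dist_ge.
have [K0|K0] := pselect (K !=set0); last first.
  exists 1 => // x' a' _ [Sa' _]; rewrite ltNge; apply/negP => h.
  by apply: K0; exists a'.
have S0 : S !=set0 by case: K0 => k [Sk _]; exists k.
have [a1 na1] := nearest_exists x S0.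
have a1a := ua _ na1; rewrite a1a in na1.
have [|c] := @compact_EVT_min _ R (fun y => dist y x) K K0 cK.
  by apply: continuous_subspaceT; exact: dist_continuousl.
rewrite inE => -[Sc ec] h.
have gt : dist x a < dist x c.
  rewrite ltNge; apply/negP => hle.
  have : nearest S x c.
    by split=> // b Sb; apply: le_trans hle _; exact: na1.2.
  by move=> /ua ca; move: ec; rewrite ca /= distxx leNgt e0.
exists ((dist x c - dist x a) / 2); first by rewrite divr_gt0 // subr_gt0.
move=> x' a' hx' [Sa' ha']; rewrite ltNge; apply/negP => ea'.
have := h a'; rewrite inE => /(_ (conj Sa' ea')).
have := ha' _ na1.1; have := dist_triangle x' a' x; have := dist_triangle x x' a.
rewrite (distC a' x') (distC c x) => *; lra.
Qed.

Lemma nearest_unique_nbhd x : ~ medial_axis S x ->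
  exists2 r : R, 0 < r &
    forall y a b, dist y x < r -> nearest S y a -> nearest S y b -> a = b.
Proof.
move=> nM; apply: contrapT => h; apply: nM => B /nbhs_distP[e e0 eB].
apply: contrapT => h'; apply: h; exists e => // y a b ye na nb.
apply: contrapT => /eqP ab; apply: h'; exists y; split; last exact: eB.
by exists a, b.
Qed.

(** The equality case of the triangle inequality: a displacement of length at most [r] that
    lengthens [u] by the full [r] is along [u]. It later forces a maximum point of the distance
    function onto the ray. *)
Lemma ler_enormD_eq u v (r : R) : u != 0 -> enorm v <= r ->
  enorm u + r <= enorm (u + v) -> v = (r / enorm u) *: u.
Proof.
move=> u0 vr h; have u1 : 0 < enorm u by rewrite enorm_gt0.
have r0 : 0 <= r by apply: le_trans vr; exact: enorm_ge0.
have v2 : enorm v ^+ 2 <= r ^+ 2 by rewrite lerXn2r ?nnegrE ?enorm_ge0.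
have h2 : (enorm u + r) ^+ 2 <= enorm (u + v) ^+ 2.
  by rewrite lerXn2r ?nnegrE ?enorm_ge0 // addr_ge0 ?enorm_ge0.
move: h2; rewrite sqrrD !sqr_enorm !dotpE (dotpC v u) => h2.
apply/eqP; rewrite -subr_eq0 -dotp_eq0 eq_le dotp_ge0 andbT !dotpE (dotpC v u).
rewrite -!sqr_enorm in h2 *.
set k := r / enorm u; have k0 : 0 <= k by rewrite divr_ge0 ?enorm_ge0.
have kr : k * enorm u = r by rewrite divfK // gt_eqF.
have A : 0 <= k * (r ^+ 2 - enorm v ^+ 2) by rewrite mulr_ge0 ?subr_ge0.
have B : 0 <= k * (dotp u v + dotp u v - (r * enorm u + r * enorm u + r ^+ 2 - enorm v ^+ 2)).
  by rewrite mulr_ge0 //; lra.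
have kk : k * (k * enorm u ^+ 2) = r ^+ 2 by rewrite -kr; ring.
have kk2 : k * (r * enorm u) = r ^+ 2 by rewrite -kr; ring.
move: A B; rewrite !mulrBr !mulrDr !mulrN opprK kk kk2; lra.
Qed.

(* The distance d to S can be increased at unit speed from x: for c < 1 a maximum
   of d(y) - c |y - x| over a small closed ball is on its boundary, because d
   grows at rate 1 away from the unique, hence continuous, nearest point. *)
Lemma nearest_extend x a : ~ medial_axis S x -> nearest S x a -> x != a ->
  exists2 e : R, 0 < e & nearest S (x + e *: (x - a)) a.
Proof.
move=> nM na xa.
have S0 : S !=set0 by exists a; exact: na.1.
have [xi nxi] := choice (fun x => nearest_exists x S0).
pose D y := dist y (xi y).
have DL y b : S b -> D y <= dist y b by move=> Sb; exact: (nxi y).2.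
have Dlip y z : D y <= D z + dist y z.
  by rewrite addrC (le_trans (DL _ _ (nxi z).1)) // dist_triangle.
have Dx : D x = dist x a.
  by apply/eqP; rewrite eq_le (DL _ _ na.1) /=; exact: na.2 _ (nxi x).1.
have [e0 e00 uni] := nearest_unique_nbhd nM.
pose r := Num.min (e0 / 2) (dist x a / 2).
have xa0 : 0 < dist x a by rewrite dist_gt0.
have r0 : 0 < r by rewrite lt_min !divr_gt0.
have re0 : r < e0 by rewrite gt_min; apply/orP; left; lra.
have rxa : r < dist x a by rewrite gt_min; apply/orP; right; lra.
pose K := [set y : V | dist y x <= r].
have K0 : K !=set0 by exists x; rewrite /K /= distxx ltW.
have cK : compact K by exact: compact_dist_le.
have step (c : R) : 0 < c < 1 -> exists2 y, K y & dist x a + c * r <= D y.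
  move=> /andP[c0 c1].
  have [|y] := @compact_EVT_max _ R (fun y => D y - c * dist y x) K K0 cK.
    apply: continuous_subspaceT; apply: (@lipschitz_dist_continuous _ _ _ (1 + c)) => y z.
    have := Dlip y z; have := dist_triangle y z x.
    move=> /(ler_wpM2l (ltW c0)); rewrite (distC z y) => h1 h2; lra.
  rewrite inE => Ky hy; exists y => //.
  have := hy x; rewrite inE => /(_ _)/[dup] _; rewrite {1}/K /= distxx mulr0 subr0 Dx.
  move=> /(_ (ltW r0)) hx.
  have [yr|yr] := ltP (dist y x) r; last first.
    by have := ler_wpM2l (ltW c0) yr; lra.
  exfalso.
  have Dy0 : 0 < D y.
    have := Dlip x y; rewrite Dx (distC x y) => ?; lra.
  pose nu := (D y)^-1 *: (y - xi y).
  have nuD : dotp nu (y - xi y) = D y.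
    by rewrite dotpZl -sqr_dist -/(D y) expr2 mulKf ?gt_eqF.
  have nu1 : enorm nu = 1.
    by rewrite enormZ gtr0_norm ?invr_gt0 // -/(dist _ _) -/(D y) mulVf ?gt_eqF.
  clearbody nu.
  (* A rate between [c] and 1. While the nearest point moves by at most [(1 - c') * D y], a step [t]
     along [nu] raises the squared distance by at least [2 * t * c' * D y + t ^+ 2], which beats
     [2 * c * t * D y + c ^+ 2 * t ^+ 2]. *)
  pose c' := (1 + c) / 2.
  have [||s s0 hs] := @nearest_continuous y (xi y) ((1 - c') * D y).
  - move=> b nb; apply: (uni y) => //; exact: lt_trans yr re0.
  - by rewrite mulr_gt0 // subr_gt0 /c'; lra.
  pose t := Num.min (s / 2) (r - dist y x).
  have t0 : 0 < t by rewrite lt_min divr_gt0 //= subr_gt0.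
  have ts : t < s by rewrite gt_min; apply/orP; left; lra.
  have tr : t <= r - dist y x by rewrite ge_min lexx orbT.
  pose y' := y + t *: nu.
  have y'y : dist y' y = t by rewrite /dist /y' addrC addKr enormZ nu1 mulr1 gtr0_norm.
  have Ky' : K y'.
    by rewrite /K /= (le_trans (dist_triangle y _ _)) // y'y; lra.
  have := hs y' (xi y'); rewrite y'y => /(_ ts (nxi y')) hw.
  set w := xi y' in hw.
  have hnu : c' * D y <= dotp nu (y - w).
    have -> : y - w = (y - xi y) + (xi y - w) by rewrite addrA subrK.
    rewrite dotpDr nuD.
    have := normr_dotp_le nu (xi y - w); rewrite nu1 mul1r.
    rewrite -/(dist _ _) (distC (xi y)) ler_norml => /andP[h1 _]; lra.
  have hD : D y + c * t < D y'.
    rewrite -(ltr_pXn2r (n := 2)) ?nnegrE ?dist_ge0 //; last first.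
      by rewrite addr_ge0 ?dist_ge0 ?mulr_ge0 // ltW.
    have -> : D y' ^+ 2 = dotp (y - w) (y - w) + 2 * t * dotp nu (y - w) + t ^+ 2.
      rewrite sqr_dist -/w /y'.
      have -> : y + t *: nu - w = (y - w) + t *: nu by rewrite addrAC.
      move: (y - w) => q; rewrite !dotpE (dotpC q nu) -(sqr_enorm nu) nu1.
      by ring.
    have h1 : D y ^+ 2 <= dotp (y - w) (y - w).
      rewrite -sqr_dist lerXn2r ?nnegrE ?dist_ge0 //; apply: DL; exact: (nxi y').1.
    have h2 : 2 * t * (c' * D y) <= 2 * t * dotp nu (y - w).
      by rewrite ler_wpM2l // mulr_ge0 // ltW.
    have h3 : 2 * t * (c' * D y) = t * D y + c * (t * D y) by rewrite /c'; field.
    have h4 : c * (t * D y) < t * D y by rewrite gtr_pMl // mulr_gt0.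
    have h5 : c ^+ 2 * t ^+ 2 < t ^+ 2.
      by rewrite gtr_pMl ?exprn_gt0 // expr_lt1 // ltW.
    have -> : (D y + c * t) ^+ 2 = D y ^+ 2 + 2 * (c * (t * D y)) + c ^+ 2 * t ^+ 2 by ring.
    lra.
  have := hy y'; rewrite inE => /(_ Ky').
  have := dist_triangle y y' x; rewrite y'y => /(ler_wpM2l (ltW c0)); lra.
have [|y] := @compact_EVT_max _ R D K K0 cK.
  apply: continuous_subspaceT; apply: (@lipschitz_dist_continuous _ _ _ 1) => y z.
  by have := Dlip y z; lra.
rewrite inE => Ky hy.
have Dy : dist x a + r <= D y.
  rewrite leNgt; apply/negP => lt.
  (* The slope is at least the midpoint of 1 and the gain rate [(D y - dist x a) / r], hence above
     the best rate supposed possible; the [1 / 2] keeps it positive. *)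
  have cb : 0 < Num.max (1 / 2) ((1 + (D y - dist x a) / r) / 2) < 1.
    rewrite lt_max gt_max; apply/andP; split; first by apply/orP; left; lra.
    apply/andP; split; first lra.
    rewrite ltr_pdivrMr // mul1r -ltrBrDl.
    by rewrite ltr_pdivrMr //; lra.
  have [z Kz hz] := step _ cb.
  have := hy z; rewrite inE => /(_ Kz) hzy.
  have : (1 + (D y - dist x a) / r) / 2 * r <= D y - dist x a.
    apply: (@le_trans _ _ (Num.max (1 / 2) ((1 + (D y - dist x a) / r) / 2) * r)).
      by rewrite ler_wpM2r ?(ltW r0) // le_max lexx orbT.
    by lra.
  have -> : (1 + (D y - dist x a) / r) / 2 * r = (r + (D y - dist x a)) / 2.
    by field; rewrite gt_eqF.
  lra.
have yx : y - x = (r / dist x a) *: (x - a).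
  apply: ler_enormD_eq; rewrite ?subr_eq0 //.
  have -> : x - a + (y - x) = y - a by rewrite addrC subrKA.
  apply: le_trans Dy _; exact: DL na.1.
exists (r / dist x a); first by rewrite divr_gt0.
rewrite -yx addrC subrK; split; first exact: na.1.
move=> b Sb; apply: le_trans (DL y b Sb); apply: le_trans Dy.
by rewrite (le_trans (dist_triangle x _ _)) // addrC lerD2l.
Qed.

Lemma dist_ray a n (t : R) : dist (a + t *: n) a = `|t| * enorm n.
Proof. by rewrite /dist addrC addKr enormZ. Qed.

Lemma dist_ray2 a n (s t : R) : dist (a + s *: n) (a + t *: n) = `|s - t| * enorm n.
Proof. by rewrite /dist opprD addrACA subrr add0r -scalerBl enormZ. Qed.

Lemma nearest_between a n (s t : R) : 0 <= s <= t ->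
  nearest S (a + t *: n) a -> nearest S (a + s *: n) a.
Proof.
move=> /andP[s0 st] [Sa h]; split=> // b Sb.
have := h b Sb; have := dist_triangle (a + s *: n) (a + t *: n) b.
rewrite dist_ray2 !dist_ray !ger0_norm ?subr_ge0 ?(le_trans s0) //.
by rewrite mulrBl => h1 h2; lra.
Qed.

(** The parameters at which [a] is still nearest contain their supremum by continuity, and
    [nearest_extend] passes it as long as it is below [r]. The start [t0] is positive because
    nothing can be extended from [a] itself. *)
Lemma nearest_ray a n (t0 r : R) : n != 0 -> 0 < t0 <= r ->
  nearest S (a + t0 *: n) a ->
  (forall t, 0 < t < r -> ~ medial_axis S (a + t *: n)) ->
  nearest S (a + r *: n) a.
Proof.
move=> nn0 /andP[t00 t0r] n0 nM.
have Sa := n0.1; have n1 : 0 < enorm n by rewrite enorm_gt0.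
pose T := [set t : R | 0 <= t <= r /\ nearest S (a + t *: n) a].
have Tt0 : T t0 by split=> //; rewrite (ltW t00).
have ubT : ubound T r by move=> t [/andP[]].
have sT : has_sup T by split; [exists t0 | exists r].
have t0s : t0 <= sup T by apply: ub_le_sup => //; exists r.
have sr : sup T <= r by apply: ge_sup => //; exists t0.
have nS : nearest S (a + sup T *: n) a.
  split=> // b Sb; rewrite leNgt; apply/negP => lt.
  pose e := (dist (a + sup T *: n) a - dist (a + sup T *: n) b) / (2 * enorm n).
  have e0 : 0 < e by rewrite divr_gt0 ?subr_gt0 // mulr_gt0.
  have [t Tt ht] := sup_adherent e0 sT.
  have ts : t <= sup T by apply: ub_le_sup => //; exists r.
  have [/andP[t0' _] [_ /(_ b Sb)]] := Tt.
  have := dist_triangle (a + sup T *: n) (a + t *: n) b.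
  rewrite (distC (a + t *: n) (a + sup T *: n)) dist_ray2 dist_ray !ger0_norm ?subr_ge0 //.
  have : (sup T - t) * (2 * enorm n) < dist (a + sup T *: n) a - dist (a + sup T *: n) b.
    by rewrite -ltr_pdivlMr ?mulr_gt0 // -/e; lra.
  rewrite dist_ray ger0_norm ?(le_trans (ltW t00)) // => *; lra.
have [ltr|] := ltP (sup T) r; last first.
  by move=> rs; have -> : r = sup T by apply/eqP; rewrite eq_le rs sr.
have s0 : 0 < sup T by exact: lt_le_trans t0s.
have [||e e0] := @nearest_extend (a + sup T *: n) a _ nS.
- by apply: nM; rewrite s0 ltr.
- by rewrite -dist_gt0 dist_ray mulr_gt0 // normr_gt0 gt_eqF.
have -> : a + sup T *: n + e *: (a + sup T *: n - a) = a + (sup T + e * sup T) *: n.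
  by rewrite [a + _ - a]addrC addKr scalerA scalerDl addrA.
move=> ne; have es : 0 < e * sup T by rewrite mulr_gt0.
have [h|h] := leP r (sup T + e * sup T).
  by apply: nearest_between ne; rewrite h (le_trans (ltW s0)).
have : sup T + e * sup T <= sup T.
  by apply: ub_le_sup; [exists r | split=> //; rewrite (ltW h) addr_ge0 // ltW].
lra.
Qed.

End Nearest.

(** * Charts of a hypersurface *)

Section Calculus.
Variable R : realType.

Lemma is_derive_line (V W : normedModType R) (f : V -> W) (x v : V) (t : R) :
  differentiable f (x + t *: v) ->
  is_derive t 1 (fun s : R => f (x + s *: v)) ('d f (x + t *: v) v).
Proof.
move=> df; pose L := fun s : R => x + s *: v.
have dL : is_diff t L ( *:%R^~ v).
  have -> : L = cst x + ( *:%R^~ v) by [].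
  by apply: is_diff_eq; rewrite add0r.
have dL1 : differentiable L t by case: dL.
have dfL : differentiable (f \o L) t by exact: differentiable_comp.
apply: DeriveDef; first exact: diff_derivable.
rewrite deriveE // diff_comp //.
by rewrite /= diff_val /= scale1r.
Qed.

Lemma is_derive_line0 (V W : normedModType R) (f : V -> W) (x v : V) :
  differentiable f x ->
  is_derive (0 : R) 1 (fun s : R => f (x + s *: v)) ('d f x v).
Proof.
have := @is_derive_line V W f x v 0.
by have -> : x + 0 *: v = x by rewrite scale0r addr0.
Qed.

Lemma MVT_line (V : normedModType R) (g : V -> R) (a b : V) :
  (forall t : R, 0 <= t <= 1 -> differentiable g (a + t *: (b - a))) ->
  exists2 t : R, 0 <= t <= 1 & g b - g a = 'd g (a + t *: (b - a)) (b - a).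
Proof.
move=> dg; pose h := fun s : R => g (a + s *: (b - a)).
have dh (t : R) : t \in `[0, 1] -> is_derive t 1 h ('d g (a + t *: (b - a)) (b - a)).
  by rewrite in_itv /= => t01; apply: is_derive_line; exact: dg.
pose h' := fun t : R => 'd g (a + t *: (b - a)) (b - a).
have dho (t : R) : t \in `]0, 1[ -> is_derive t 1 h (h' t).
  by move=> t01; apply: dh; exact: subset_itv_oo_cc t01.
have ch : {within `[0, 1], continuous h}.
  by apply: derivable_within_continuous => t t01; have [] := dh t t01.
have [c c01] := MVT_segment ler01 dho ch.
rewrite subr0 mulr1 {1 2}/h scale0r addr0 scale1r [a + (b - a)]addrC subrK => hg.
by exists c => //; move: c01; rewrite in_itv.
Qed.

Lemma diff_cancel (V W : normedModType R) (f : V -> W) (g : W -> V) (a v : V) :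
  differentiable f a -> differentiable g (f a) ->
  (\forall x \near a, g (f x) = x) -> 'd g (f a) ('d f a v) = v.
Proof.
move=> df dg gf.
have := deriveE v (differentiable_comp df dg); rewrite diff_comp //= => <-.
have -> : 'D_v (g \o f) a = 'D_v id a by apply: near_eq_derive; exact: gf.
exact: derive_id.
Qed.

Lemma diff_coord (V : normedModType R) n (f : V -> 'rV[R]_n) (a v : V) i :
  differentiable f a ->
  differentiable (fun x => f x 0 i) a /\ 'd (fun x => f x 0 i) a v = ('d f a v) 0 i.
Proof.
move=> df.
have @c : {linear 'rV[R]_n -> R}.
  by exists (fun M : 'rV[R]_n => M 0 i); do 2![eexists]; do ?[constructor];
     rewrite ?mxE// => ? *; rewrite ?mxE//; move=> ?; rewrite !mxE.
have cc : continuous c by exact: coord_continuous.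
have dc : differentiable (c : 'rV[R]_n -> R) (f a) by exact: linear_differentiable.
split; first exact: (differentiable_comp df dc).
have e : 'd (c : 'rV[R]_n -> R) (f a) ('d f a v) = c ('d f a v).
  by rewrite (diff_lin _ cc).
exact: etrans (congr1 (@^~ v) (diff_comp df dc)) e.
Qed.

End Calculus.

Section Lines.
Variables (R : realType) (d : nat).
Local Notation V := 'rV[R]_d.
Implicit Types (x v : V).

Lemma line_nbhs x v (A : set V) : nbhs x A ->
  exists2 e : R, 0 < e & forall t, `|t| < e -> A (x + t *: v).
Proof.
move=> /nbhs_distP[e e0 h].
have v1 : 0 < enorm v + 1 by rewrite ltr_wpDl ?enorm_ge0.
exists (e / (enorm v + 1)); first by rewrite divr_gt0.
move=> t; rewrite ltr_pdivlMr // => ht; apply: h.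
rewrite /dist addrC addKr enormZ; apply: le_lt_trans ht.
by rewrite ler_wpM2l // lerDl.
Qed.

Lemma line_near x v (A : set V) : nbhs x A -> \forall t \near (0 : R), A (x + t *: v).
Proof.
move=> /(line_nbhs v)[e e0 h]; apply/nbhs_ballP; exists e => // t.
by rewrite -ball_normE /ball_ /= sub0r normrN => /h.
Qed.

Lemma is_derive_pos_sign (g : R -> R) (c : R) : is_derive (0 : R) 1 g c -> g 0 = 0 -> 0 < c ->
  exists2 e : R, 0 < e & forall t, 0 < t < e -> 0 < g t /\ g (- t) < 0.
Proof.
move=> [dg gc] g0 c0.
have cvg : (fun h => h^-1 *: (g (h *: 1 + 0) - g 0)) @ 0^' --> c by rewrite -gc.
have /(cvgr_gt _ cvg) := c0.
move=> /nbhs_ballP[e /= e0 h]; exists e => // t /andP[t0 te].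
have ht (s : R) : `|s| < e -> s != 0 -> 0 < s^-1 * g s.
  move=> se s0; have := h s; rewrite -ball_normE /ball_ /= sub0r normrN => /(_ se s0).
  by rewrite g0 subr0 addr0 [s%:A]mulr1.
have h1 : 0 < t^-1 * g t by apply: ht; rewrite ?gt_eqF // gtr0_norm.
have h2 : 0 < (- t)^-1 * g (- t).
  by apply: ht; rewrite ?oppr_eq0 ?gt_eqF // normrN gtr0_norm.
rewrite pmulr_rgt0 ?invr_gt0 // in h1; split=> //.
by rewrite nmulr_rgt0 ?invr_lt0 ?oppr_lt0 // in h2.
Qed.

End Lines.

(** * Tangent vectors, normals and second-order estimates in a slice chart *)

Section Chart.
Variables (R : realType) (d : nat) (S U W : set 'rV[R]_d.+1).
Variables (phi psi : 'rV[R]_d.+1 -> 'rV[R]_d.+1).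
Local Notation V := 'rV[R]_d.+1.
Implicit Types (u v w x y z n a b : V).
Hypothesis dfo : diffeo U W phi psi.
Hypothesis slice : forall x, U x -> (S x <-> phi x 0 ord_max = 0).

(** In codimension 1 the last coordinate of the chart is a local defining function of [S]; this is
    its differential. *)
Let df a v := ('d phi a v) 0 ord_max.

Lemma chart_nbhs a : U a -> nbhs a U.
Proof. by case: dfo => -[oU _ _ _] _ Ua; exact: open_nbhs_nbhs. Qed.

Lemma chart_inv_nbhs y : W y -> nbhs y W.
Proof. by case: dfo => -[_ oW _ _] _ Wy; exact: open_nbhs_nbhs. Qed.

Lemma chart_differentiable a : U a -> differentiable phi a.
Proof. by case: dfo => -[_ _ sp _] _; exact: (sp 1%N).1. Qed.

Lemma chart_inv_differentiable y : W y -> differentiable psi y.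
Proof. by case: dfo => -[_ _ _ sp] _; exact: (sp 1%N).1. Qed.

Lemma chartK a : U a -> psi (phi a) = a.
Proof. by case: dfo => _ [h _] Ua; case: (h a Ua). Qed.

Lemma chart_in a : U a -> W (phi a).
Proof. by case: dfo => _ [h _] Ua; case: (h a Ua). Qed.

Lemma chart_invK y : W y -> phi (psi y) = y.
Proof. by case: dfo => _ [_ h] Ua; case: (h y Ua). Qed.

Lemma chart_inv_in y : W y -> U (psi y).
Proof. by case: dfo => _ [_ h] Ua; case: (h y Ua). Qed.

Lemma chart_diffK a v : U a -> 'd psi (phi a) ('d phi a v) = v.
Proof.
move=> Ua; apply: diff_cancel; first exact: chart_differentiable.
  exact/chart_inv_differentiable/chart_in.
by apply: filterS (chart_nbhs Ua) => x; exact: chartK.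
Qed.

Lemma chart_diff_invK a w : U a -> 'd phi a ('d psi (phi a) w) = w.
Proof.
move=> Ua.
have : 'd phi (psi (phi a)) ('d psi (phi a) w) = w; last by rewrite chartK.
apply: diff_cancel.
- exact/chart_inv_differentiable/chart_in.
- by apply: chart_differentiable; rewrite chartK.
by apply: filterS (chart_inv_nbhs (chart_in Ua)) => x; exact: chart_invK.
Qed.

Lemma chart_line_derive a v : U a ->
  is_derive (0 : R) 1 (fun t : R => phi (a + t *: v) 0 ord_max) (df a v).
Proof.
move=> Ua; have da := chart_differentiable Ua.
have [dc dcE] := diff_coord v ord_max da.
by have := is_derive_line0 v dc; rewrite dcE.
Qed.

(** The defining function vanishes along curves in [S]; conversely the straight line in the slice
    with direction ['d phi a v], pulled back by [psi], has velocity [v]. *)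
Lemma tangent_vectorP a v : U a -> S a -> tangent_vector S a v <-> df a v = 0.
Proof.
move=> Ua Sa; split.
  move=> [g [g0 Sg [dg gv]]]; subst a.
  have da := chart_differentiable Ua.
  have dg1 : differentiable g 0 by apply/derivable1_diffP.
  have [dc dcE] := diff_coord v ord_max da.
  rewrite /df -dcE -gv deriveE //.
  transitivity ('d ((fun x => phi x 0 ord_max) \o g) 0 1); first exact: (esym (congr1 (@^~ 1) (diff_comp dg1 dc))).
  rewrite -deriveE; last exact: differentiable_comp dg1 dc.
  transitivity ('D_(1 : R) (cst (0 : R)) (0 : R)); last by rewrite derive_cst.
  apply: near_eq_derive.
  have : \forall t \near (0 : R), U (g t).
    by apply: (differentiable_continuous dg1); exact: chart_nbhs.
  by apply: filterS2 Sg => t Sgt Ugt /=; exact/(slice Ugt).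
move=> dfv; exists (fun t => psi (phi a + t *: 'd phi a v)); split.
- by rewrite scale0r addr0 chartK.
- apply: filterS (line_near ('d phi a v) (chart_inv_nbhs (chart_in Ua))) => t Wt.
  apply/(slice (chart_inv_in Wt)); rewrite chart_invK // !mxE.
  by rewrite (slice Ua).1 // add0r -/(df a v) dfv mulr0.
- have dpsi := chart_inv_differentiable (chart_in Ua).
  exact: is_derive_eq (is_derive_line0 ('d phi a v) dpsi) (chart_diffK v Ua).
Qed.

Definition chart_grad a : V := \row_i df a (delta_mx 0 i).

Lemma chart_gradE a v : df a v = dotp (chart_grad a) v.
Proof.
rewrite {1}(row_sum_delta v) /df linear_sum summxE; apply: eq_bigr => i _.
by rewrite linearZ !mxE mulrC.
Qed.

Lemma chart_grad_coord a i : U a ->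
  chart_grad a 0 i = ('D_(delta_mx 0 i) phi a) 0 ord_max.
Proof. by move=> Ua; rewrite mxE (deriveE _ (chart_differentiable Ua)). Qed.

Lemma chart_grad_neq0 a : U a -> chart_grad a != 0.
Proof.
move=> Ua; apply/eqP => g0.
have : df a ('d psi (phi a) (delta_mx 0 ord_max)) = 0.
  by rewrite chart_gradE g0 dotpC dotp0r.
by rewrite /df chart_diff_invK // mxE !eqxx => /eqP; rewrite oner_eq0.
Qed.

(** The part [n'] of [n] orthogonal to the gradient is tangent, hence orthogonal to [n] as well as
    to the gradient, hence to itself. *)
Lemma normal_chart_grad a n : U a -> S a ->
  (forall v, tangent_vector S a v -> dotp n v = 0) ->
  exists k : R, n = k *: chart_grad a.
Proof.
move=> Ua Sa nn; set g := chart_grad a.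
have g0 : dotp g g != 0 by rewrite dotp_eq0 chart_grad_neq0.
pose n' := n - (dotp g n / dotp g g) *: g.
have gn' : dotp g n' = 0 by rewrite /n' !dotpE divfK // subrr.
have nn' : dotp n n' = 0.
  by apply: nn; apply/tangent_vectorP => //; rewrite chart_gradE.
exists (dotp g n / dotp g g); apply/eqP; rewrite -subr_eq0 -/n' -dotp_eq0.
by rewrite {1}/n' dotpDl nn' dotpNl dotpZl gn' mulr0 oppr0 addr0.
Qed.

Lemma tangent_orthogonal a n v : U a -> S a -> n != 0 ->
  (forall v, tangent_vector S a v -> dotp n v = 0) ->
  dotp n v = 0 -> tangent_vector S a v.
Proof.
move=> Ua Sa n0 /(normal_chart_grad Ua Sa)[k nk]; rewrite nk dotpZl => /eqP.
rewrite mulf_eq0 => /orP[/eqP k0|/eqP h]; first by move: n0; rewrite nk k0 scale0r eqxx.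
by apply/tangent_vectorP => //; rewrite chart_gradE.
Qed.

Lemma chart_normal_transverse a n : U a -> S a -> n != 0 ->
  (forall v, tangent_vector S a v -> dotp n v = 0) -> df a n != 0.
Proof.
move=> Ua Sa n0 nn; apply/eqP => h.
have : dotp n n = 0 by apply: nn; exact/tangent_vectorP.
by move/eqP; rewrite dotp_eq0; apply/negP.
Qed.

Lemma diff_coord_bound (G : V -> V) z v (M : R) : differentiable G z ->
  (forall j, `|('D_(delta_mx 0 j) G z) 0 ord_max| <= M) ->
  `|('d G z v) 0 ord_max| <= d.+1%:R * M * enorm v.
Proof.
move=> dG hM; rewrite {1}(row_sum_delta v) linear_sum summxE.
apply: le_trans (ler_norm_sum _ _ _) _.
have -> : d.+1%:R * M * enorm v = \sum_(j < d.+1) (M * enorm v).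
  by rewrite sumr_const card_ord -[RHS]mulr_natl mulrA.
apply: ler_sum => j _.
rewrite linearZ mxE normrM mulrC ler_pM //.
  by rewrite -deriveE.
exact: le_trans (normr_coord_le _ _) (norm_le_enorm _).
Qed.

Lemma dist_segment_lt a b p (r t : R) : 0 <= t <= 1 -> dist a p < r -> dist b p < r ->
  dist (a + t *: (b - a)) p < r.
Proof.
move=> /andP[t0 t1] ar br.
have -> : dist (a + t *: (b - a)) p = enorm ((1 - t) *: (a - p) + t *: (b - p)).
  congr enorm; apply/rowP => i; rewrite !mxE; ring.
apply: le_lt_trans (ler_enormD _ _) _; rewrite !enormZ !ger0_norm ?subr_ge0 //.
rewrite -/(dist a p) -/(dist b p).
have [->|tn1] := eqVneq t 1; first by rewrite subrr mul0r add0r mul1r.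
have t1' : 0 < 1 - t by rewrite subr_gt0 lt_neqAle tn1.
have -> : r = (1 - t) * r + t * r by ring.
by rewrite ltr_leD ?ltr_pM2l // ler_wpM2l // ltW.
Qed.

Lemma ler_sum2 (m : nat) (g : 'I_m -> 'I_m -> R) i j :
  `|g i j| <= \sum_i \sum_j `|g i j|.
Proof.
rewrite (bigD1 i) //= (bigD1 j) //= -addrA lerDl addr_ge0 ?sumr_ge0 // => k _.
exact: sumr_ge0.
Qed.

Lemma chart_second_bound p : U p -> exists2 r : R, 0 < r &
  exists2 M : R, 0 <= M & forall x, dist x p < r -> U x /\
    forall i j, `|('D_(delta_mx 0 j) ('D_(delta_mx 0 i) phi) x) 0 ord_max| <= M.
Proof.
move=> Up; case: dfo => -[_ _ sp _] _.
pose h i j x := ('D_(delta_mx 0 j) ('D_(delta_mx 0 i) phi) x) 0 ord_max.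
pose M := \sum_i \sum_j `|h i j p| + 1.
have hM i j : `|h i j p| + 1 <= M by rewrite /M lerD2r ler_sum2.
have hc i j : {for p, continuous (h i j)}.
  (* Class 3 makes the second derivatives differentiable, which yields their continuity at [p]. *)
  have := (((sp 3%N).2 (delta_mx 0 i)).2 (delta_mx 0 j)).1 p Up.
  move=> /(diff_coord 0 ord_max)[dh _]; exact: differentiable_continuous dh.
have near_h : \forall x \near p, U x /\ forall i j, `|h i j x| <= M.
  have hij : \forall x \near p, forall ij : ('I_d.+1 * 'I_d.+1)%type, `|h ij.1 ij.2 x| <= M.
    apply: (@filter_forall _ _ (fun (ij : 'I_d.+1 * 'I_d.+1) x => is_true (`|h ij.1 ij.2 x| <= M)) (nbhs p)) => -[i j] /=.
    have := hc i j => /cvgrPdist_lt /(_ 1 ltr01).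
    apply: filterS => x hx; apply: le_trans (hM i j).
    rewrite -lerBlDl; apply: le_trans (ltW hx); rewrite distrC; exact: lerB_dist.
  apply: filterS2 (chart_nbhs Up) hij => x Ux hx; split=> // i j.
  exact: (hx (i, j)).
have /nbhs_distP[r r0 hr] := near_h.
exists r => //; exists M => //.
by rewrite addr_ge0 // sumr_ge0 // => i _; exact: sumr_ge0.
Qed.

(** The mean value theorem is used twice: for the defining function along the segment, then for its
    partial derivatives. Both endpoints vary near [p] with a single constant, since the nearest
    points to be compared later need not be [p]. *)
Lemma chart_quadratic p : U p -> exists2 r : R, 0 < r &
  exists2 K : R, 0 <= K & forall a b, dist a p < r -> dist b p < r ->
    [/\ U a, U b &
      `|phi b 0 ord_max - phi a 0 ord_max - df a (b - a)| <= K * dist b a ^+ 2].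
Proof.
move=> Up; have [r r0 [M M0 hM]] := chart_second_bound Up.
exists r => //; exists (d.+1%:R * (d.+1%:R * M)); first by rewrite !mulr_ge0.
move=> a b ar br; have Ua := (hM a ar).1; have Ub := (hM b br).1; split=> //.
case: (dfo) => -[_ _ sp _] _.
have Dlip i x y : dist x p < r -> dist y p < r ->
    `|('D_(delta_mx 0 i) phi y) 0 ord_max - ('D_(delta_mx 0 i) phi x) 0 ord_max|
    <= d.+1%:R * M * dist y x.
  move=> xr yr; pose G := 'D_(delta_mx 0 i) phi.
  have dG (t : R) : 0 <= t <= 1 -> differentiable G (x + t *: (y - x)).
    move=> t01; apply: ((sp 2%N).2 (delta_mx 0 i)).1.
    by have [] := hM _ (dist_segment_lt t01 xr yr).
  have [|t t01 ->] := @MVT_line R V (fun x => G x 0 ord_max) x y.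
    by move=> t t01; have [] := diff_coord 0 ord_max (dG t t01).
  have [_ ->] := diff_coord (y - x) ord_max (dG t t01).
  apply: diff_coord_bound; first exact: dG.
  by move=> j; have [_] := hM _ (dist_segment_lt t01 xr yr); apply.
have [|t t01 ->] := @MVT_line R V (fun x => phi x 0 ord_max) a b.
  move=> t t01; have [] // := diff_coord 0 ord_max (chart_differentiable (_ : U (a + t *: (b - a)))).
  by have [] := hM _ (dist_segment_lt t01 ar br).
set z := a + t *: (b - a).
have zr : dist z p < r by exact: dist_segment_lt.
have za : dist z a <= dist b a.
  rewrite /z dist_ray.
  by case/andP: t01 => t0 t1; rewrite ger0_norm // ler_piMl ?enorm_ge0.
clearbody z; have Uz := (hM z zr).1.
have [_ ->] := diff_coord (b - a) ord_max (chart_differentiable Uz).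
rewrite -/(df z _) !chart_gradE -dotpNl -dotpDl.
have gza i : `|(chart_grad z - chart_grad a) 0 i| <= d.+1%:R * M * dist b a.
  have -> : (chart_grad z - chart_grad a) 0 i = chart_grad z 0 i - chart_grad a 0 i.
    by move: (chart_grad z) (chart_grad a) => g g'; rewrite !mxE.
  have ez := chart_grad_coord i Uz.
  have ea := chart_grad_coord i Ua.
  have h := Dlip i a z ar zr.
  have k0 : 0 <= d.+1%:R * M by rewrite mulr_ge0.
  have h' := ler_wpM2l k0 za.
  have transport (u v u' v' K : R) : u = u' -> v = v' -> `|u' - v'| <= K -> `|u - v| <= K.
    by move=> -> ->.
  exact: transport ez ea (le_trans h h').
move: (chart_grad z - chart_grad a) gza => g hg.
apply: le_trans (ler_norm_sum _ _ _) _.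
have -> : d.+1%:R * (d.+1%:R * M) * dist b a ^+ 2 = \sum_(i < d.+1) (d.+1%:R * M * dist b a * dist b a).
  by rewrite sumr_const card_ord -[RHS]mulr_natl expr2 !mulrA.
apply: ler_sum => i _; rewrite normrM ler_pM //.
exact: le_trans (normr_coord_le _ _) (norm_le_enorm _).
Qed.

End Chart.

(** * Second-order contact with tangent hyperplanes, and nearest points *)

Section Hypersurface.
Variables (R : realType) (d : nat) (S : set 'rV[R]_d.+1).
Local Notation V := 'rV[R]_d.+1.
Implicit Types (u v w x y z n a b p q : V).
Hypothesis mS : submanifold d S.

Lemma hypersurface_chart p : S p -> exists U W phi psi,
  [/\ @diffeo R d.+1 U W phi psi, U p &
      forall x, U x -> (S x <-> phi x 0 ord_max = 0)].
Proof.
move=> Sp; have [U [W [phi [psi [dfo Up sl]]]]] := mS Sp.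
exists U, W, phi, psi; split=> // x Ux; rewrite sl //; split=> [->//|h i di].
by have -> : i = ord_max by apply/val_inj/eqP; rewrite eqn_leq /= di -ltnS ltn_ord.
Qed.

Definition normal_at a n := forall v, tangent_vector S a v -> dotp n v = 0.

(** On [S] the defining function is 0, so [chart_quadratic] bounds its differential alone. Passing
    from the gradient to an arbitrary normal costs a lower bound on the gradient near [p]. *)
Lemma normal_quadratic p : S p -> exists2 r : R, 0 < r &
  exists2 K : R, 0 <= K & forall a b n, S a -> S b -> dist a p < r -> dist b p < r ->
    normal_at a n -> `|dotp n (b - a)| <= K * enorm n * dist b a ^+ 2.
Proof.
move=> Sp; have [U [W [phi [psi [dfo Up sl]]]]] := hypersurface_chart Sp.
have [r1 r10 [K K0 hK]] := chart_quadratic dfo Up.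
(* The defining function has derivative 1 along [w] at [p], hence more than [1 / 2] nearby, which
   bounds the gradient from below. *)
pose w := 'd psi (phi p) (delta_mx 0 ord_max).
have dw : differentiable ('D_w phi) p.
  by case: (dfo) => -[_ _ sp _] _; exact: ((sp 2%N).2 w).1.
have [dwc _] := diff_coord 0 ord_max dw.
have cw := differentiable_continuous dwc.
have Dwp : ('D_w phi p) 0 ord_max = 1.
  rewrite (deriveE _ (chart_differentiable dfo Up)) (chart_diff_invK dfo _ Up).
  by rewrite mxE !eqxx.
have [r2 r20 hr2] : exists2 r : R, 0 < r & forall a, dist a p < r -> 1 / 2 < ('D_w phi a) 0 ord_max.
  apply/nbhs_distP; apply: (@cvgr_gt _ _ _ _ _ _ cw); rewrite /= Dwp; lra.
exists (Num.min r1 r2); first by rewrite lt_min r10.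
exists (K * (2 * (enorm w + 1))); first by rewrite !mulr_ge0 // addr_ge0 ?enorm_ge0.
move=> a b n Sa Sb; rewrite !lt_min => /andP[ar1 ar2] /andP[br1 br2] nn.
have [Ua Ub] := hK a b ar1 br1.
rewrite ((sl _ Ua).1 Sa) ((sl _ Ub).1 Sb) subrr add0r normrN => hq.
have [k nk] := normal_chart_grad dfo sl Ua Sa nn.
have {hq}hq : `|dotp (chart_grad phi a) (b - a)| <= K * dist b a ^+ 2.
  by have := chart_gradE phi a (b - a) => <-.
have hg : 1 / 2 <= enorm (chart_grad phi a) * (enorm w + 1).
  apply: le_trans (ltW (hr2 a ar2)) _.
  rewrite (deriveE _ (chart_differentiable dfo Ua)) chart_gradE.
  apply: le_trans (dotp_le_enorm _ _) _.
  by rewrite ler_wpM2l ?enorm_ge0 // lerDl.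
move: (chart_grad phi a) nk hq hg => g -> hq hg.
rewrite dotpZl normrM enormZ.
apply: (@le_trans _ _ (`|k| * (K * dist b a ^+ 2))); first by rewrite ler_wpM2l.
have e : K * (2 * (enorm w + 1)) * (`|k| * enorm g) * dist b a ^+ 2 =
  `|k| * (K * dist b a ^+ 2) * (2 * (enorm g * (enorm w + 1))) by ring.
rewrite e ler_peMr ?mulr_ge0 ?exprn_ge0 ?dist_ge0 //; lra.
Qed.

(** First variation: if [v] had a nonzero component along [x - a], the curve would approach [x] on
    one side of time 0. A curve is only known to be differentiable at 0, so difference quotients are
    estimated directly. *)
Lemma nearest_normal x a : nearest S x a -> normal_at a (x - a).
Proof.
move=> na v [g [g0 Sg [dg gv]]].
apply/eqP/negP => /negP c0; set w := x - a in c0 *; set c := dotp w v in c0 *.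
have cvg : (fun h => h^-1 *: (g (h *: 1 + 0) - g 0)) @ 0^' --> v by rewrite -gv.
(* Precision [e] puts the difference quotient [q] below [m] in norm and [dotp w q] within half of
   [c]. The step [s] then makes the second-order term, at most [s ^+ 2 * m ^+ 2], smaller than the
   first-order gain [s * |c|]. *)
pose e := Num.min 1 (`|c| / (2 * (enorm w + 1))).
have w1 : 0 < enorm w + 1 by rewrite ltr_wpDl ?enorm_ge0.
have e0 : 0 < e by rewrite lt_min ltr01 divr_gt0 ?normr_gt0 // mulr_gt0.
have /nbhs_ballP[s1 /= s10 h1] := cvg _ (dist_nbhs v e0).
have /nbhs_ballP[s2 /= s20 h2] := Sg.
pose m := enorm v + 1.
have m0 : 0 < m by rewrite ltr_wpDl ?enorm_ge0.
pose s := Num.min (Num.min s1 s2 / 2) (`|c| / (2 * m ^+ 2)).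
have mn0 : 0 < Num.min s1 s2 by rewrite lt_min s10.
have s0 : 0 < s by rewrite lt_min !divr_gt0 ?normr_gt0 // mulr_gt0 ?exprn_gt0.
have ss : s < Num.min s1 s2 by rewrite gt_min; apply/orP; left; lra.
have [ss1 ss2] : s < s1 /\ s < s2 by move: ss; rewrite lt_min => /andP.
have sm : s * m ^+ 2 < `|c|.
  apply: (@le_lt_trans _ _ (`|c| / 2)); last first.
    by rewrite ltr_pdivrMr // ltr_pMr ?normr_gt0 // ltr1n.
  rewrite -ler_pdivlMr ?exprn_gt0 // -mulrA -invfM.
  by rewrite /s ge_min lexx orbT.
pose t := Num.sg c * s.
have tn : `|t| = s by rewrite normrM normr_sg c0 mul1r gtr0_norm.
have t0 : t != 0 by rewrite -normr_eq0 tn gt_eqF.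
have := h1 t; rewrite -ball_normE /ball_ /= sub0r normrN tn => /(_ ss1 t0).
rewrite addr0 [t%:A]mulr1 g0.
set q := t^-1 *: _ => hq.
have := h2 t; rewrite -ball_normE /ball_ /= sub0r normrN tn => /(_ ss2) Sgt.
have gt : g t = a + t *: q by rewrite /q scalerA mulfV // scale1r addrC subrK.
clearbody q.
have := na.2 _ Sgt; rewrite gt.
rewrite -(ler_pXn2r (n := 2)) ?nnegrE ?dist_ge0 // !sqr_dist opprD addrA -/w.
clearbody w; rewrite !dotpE opprK (dotpC q w) -(sqr_enorm q) => h3.
have hqm : enorm q ^+ 2 <= m ^+ 2.
  rewrite lerXn2r ?nnegrE ?enorm_ge0 ?(ltW m0) //.
  have -> : q = (q - v) + v by rewrite subrK.
  apply: le_trans (ler_enormD _ _) _; rewrite addrC lerD2l.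
  by rewrite (le_trans (ltW hq)) // ge_min lexx.
have hqc : `|dotp w q - c| <= `|c| / 2.
  rewrite /c -dotpNr -dotpDr; apply: le_trans (normr_dotp_le _ _) _.
  apply: (@le_trans _ _ ((enorm w + 1) * (`|c| / (2 * (enorm w + 1))))).
    rewrite ler_pM ?enorm_ge0 ?lerDl //.
    by rewrite (le_trans (ltW hq)) // ge_min lexx orbT.
  have -> // : (enorm w + 1) * (`|c| / (2 * (enorm w + 1))) = `|c| / 2.
  by field; rewrite gt_eqF.
have hs : `|c| / 2 <= Num.sg c * dotp w q.
  move: hqc; have [cp|cp|cp] := ltrgtP c 0.
  - by rewrite ltr0_sg // (ltr0_norm cp) ler_norml mulN1r => /andP[? ?]; lra.
  - by rewrite gtr0_sg // (gtr0_norm cp) ler_norml mul1r => /andP[? ?]; lra.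
  - by move: c0; rewrite cp eqxx.
have : s * (Num.sg c * dotp w q) = t * dotp w q by rewrite /t; ring.
have t2 : t ^+ 2 = s ^+ 2 by rewrite -[LHS]real_normK ?num_real // tn.
have := ler_wpM2l (ltW s0) hs => h4 h5.
have h6 := ler_wpM2l (sqr_ge0 s) hqm.
have h7 : s * (s * m ^+ 2) < s * `|c| by rewrite ltr_pM2l.
have h8 : t * (t * enorm q ^+ 2) = s ^+ 2 * enorm q ^+ 2 by rewrite -t2; ring.
have h9 : s ^+ 2 * m ^+ 2 = s * (s * m ^+ 2) by ring.
have h10 : s * (`|c| / 2) = s * `|c| / 2 by ring.
clear -h3 h4 h5 h6 h7 h8 h9 h10; lra.
Qed.

Lemma sqr_distD x y z : dist x z ^+ 2 = dist x y ^+ 2 - 2 * dotp (x - y) (z - y) + dist z y ^+ 2.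
Proof.
have -> : dist x z ^+ 2 = dotp ((x - y) - (z - y)) ((x - y) - (z - y)).
  by rewrite sqr_dist opprB addrA subrK.
rewrite !sqr_dist; move: (x - y) (z - y) => u v.
by rewrite !dotpE (dotpC v u); ring.
Qed.

(** If [x] near [p] had two nearest points [a] and [b], equal distances would give
    [|b - a|^2 = 2 (x - a).(b - a)]. As [x - a] is normal at [a], the right side is at most
    [2 K |x - a| |b - a|^2], too small when [x] is close to [p]. *)
Lemma notin_medial_axis p : S p -> ~ medial_axis S p.
Proof.
move=> Sp Mp; have [r r0 [K K0 hK]] := normal_quadratic Sp.
pose r' := Num.min (r / 2) (1 / (2 * (K + 1))).
have K1 : 0 < K + 1 by rewrite ltr_wpDl.
have r'0 : 0 < r' by rewrite lt_min !divr_gt0 // mulr_gt0.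
have [x [[a [b [na nb ab]]] /= xr]] := Mp _ (dist_nbhs p r'0).
have r'r : r' <= r / 2 by rewrite ge_min lexx.
have r'K : r' * (2 * (K + 1)) <= 1.
  by rewrite -ler_pdivlMr ?mulr_gt0 // ge_min lexx orbT.
have near_p c : nearest S x c -> dist c p < r.
  move=> [_ /(_ _ Sp) h]; have := dist_triangle x c p; rewrite (distC c x); lra.
have ab0 : 0 < dist b a ^+ 2 by rewrite exprn_gt0 // dist_gt0 eq_sym.
have eab : dist x a = dist x b.
  by apply/eqP; rewrite eq_le (na.2 _ nb.1) (nb.2 _ na.1).
have := hK _ _ _ na.1 nb.1 (near_p _ na) (near_p _ nb) (nearest_normal na).
rewrite -/(dist x a) => h1.
have := sqr_distD x a b; rewrite -eab => h2.
have h3 : K * dist x a * dist b a ^+ 2 <= K * r' * dist b a ^+ 2.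
  rewrite ler_wpM2r ?(ltW ab0) // ler_wpM2l //.
  by rewrite (le_trans (na.2 _ Sp)) // ltW.
have h4 : 2 * (K * r') * dist b a ^+ 2 < dist b a ^+ 2.
  rewrite gtr_pMl //; nra.
have := ler_norm (dotp (x - a) (b - a)); lra.
Qed.

Hypothesis cS : compact S.

(** Any point of [S] nearest to [x = p + t *: n] is within [2 |x - p|] of [p], hence in the range of
    the quadratic bound, which shows that it is no nearer than [p]. This reduces a global claim to a
    local one. *)
Lemma nearest_along_normal p n : S p -> n != 0 -> normal_at p n ->
  exists2 t : R, 0 < t & nearest S (p + t *: n) p.
Proof.
move=> Sp n0 nn; have [r r0 [K K0 hK]] := normal_quadratic Sp.
have n1 : 0 < enorm n by rewrite enorm_gt0.
pose t := Num.min (r / (3 * enorm n)) (1 / (2 * (K * enorm n + 1))).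
have K1 : 0 < K * enorm n + 1 by rewrite ltr_wpDl // mulr_ge0 // ltW.
have t0 : 0 < t by rewrite lt_min !divr_gt0 // mulr_gt0.
have tr : t * (3 * enorm n) <= r by rewrite -ler_pdivlMr ?mulr_gt0 // ge_min lexx.
have tK : t * (2 * (K * enorm n + 1)) <= 1.
  by rewrite -ler_pdivlMr ?mulr_gt0 // ge_min lexx orbT.
exists t => //; set x := p + t *: n.
have xp : dist x p = t * enorm n by rewrite dist_ray gtr0_norm.
have tn0 : 0 < t * enorm n by rewrite mulr_gt0.
have [a na] := nearest_exists cS x (ex_intro _ p Sp).
split=> // b Sb; apply: le_trans (na.2 _ Sb).
have xa := na.2 _ Sp.
have ap : dist a p < r by have := dist_triangle x a p; rewrite (distC a x); lra.
have := hK _ _ _ Sp na.1 (_ : dist p p < r) ap nn; rewrite distxx => /(_ r0) h1.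
have := sqr_distD x p a.
have -> : x - p = t *: n by rewrite /x addrC addKr.
rewrite dotpZl => h2.
have h3 : t * dotp n (a - p) <= t * (K * enorm n * dist a p ^+ 2).
  by rewrite ler_wpM2l ?(ltW t0) // (le_trans (ler_norm _)).
have h4 : 2 * (t * (K * enorm n)) * dist a p ^+ 2 <= dist a p ^+ 2.
  rewrite ler_piMl ?sqr_ge0 //; nra.
rewrite -(ler_pXn2r (n := 2)) ?nnegrE ?dist_ge0 //; lra.
Qed.

End Hypersurface.

(** * Sides of a hypersurface *)

Section Connected.
Variable R : realType.

Lemma connected_locally_constant (T : topologicalType) (U : Type) (A : set T) (s : T -> U) :
  connected A -> (forall x, A x -> \forall y \near x, A y -> s y = s x) ->
  forall x y, A x -> A y -> s x = s y.
Proof.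
move=> cA hs x y Ax Ay; pose B := A `&` [set z | s z = s x].
suff BA : B = A by move: Ay; rewrite -BA => -[_ ->].
apply: cA; first by exists x.
- exists [set z | A z -> s z = s x]°; first exact: open_interior.
  apply/seteqP; split=> z [Az hz]; split=> //; last exact: (interior_subset hz).
  rewrite /interior /=; apply: filterS (hs z Az) => w hw Aw; rewrite hw //.
- exists (~` [set z | A z -> s z <> s x]°); first by apply: open_closedC; exact: open_interior.
  apply/seteqP; split=> z [Az hz]; split=> //.
    by move=> /interior_subset /(_ Az); apply.
  apply: contrapT => nz; apply: hz; rewrite /interior /=.
  by apply: filterS (hs z Az) => w hw Aw; rewrite hw.
Qed.

Lemma connected_component_path (T : topologicalType) (A : set T) (g : R -> T) :
  {within `[0, 1], continuous g} -> (forall t : R, 0 <= t <= 1 -> A (g t)) ->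
  connected_component A (g 0) (g 1).
Proof.
move=> cg Ag.
have c := connected_continuous_connected (@segment_connected R 0 1) cg.
apply: (@connected_component_max _ A (g @` `[0, 1]) (g 0) _ _ c).
- by exists 0 => //; rewrite /= in_itv /= lexx ler01.
- by move=> _ [t /= + <-]; rewrite in_itv => /Ag.
- by exists 1 => //; rewrite /= in_itv /= lexx ler01.
Qed.

Lemma open_dist_lt d (a : 'rV[R]_d) (e : R) : open [set y | dist y a < e].
Proof.
rewrite openE => y /= ye; apply/nbhs_distP; exists (e - dist y a); first by rewrite subr_gt0.
by move=> z hz /=; have := dist_triangle y z a; lra.
Qed.

Lemma continuous_line d (x v : 'rV[R]_d) : continuous (fun t : R => x + t *: v).
Proof.
move=> t; apply: (@differentiable_continuous _ _ _ t (fun t : R => x + t *: v)).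
by apply: differentiableD.
Qed.

Lemma connected_component_segment d (A : set 'rV[R]_d) (x y : 'rV[R]_d) :
  (forall t : R, 0 <= t <= 1 -> A (x + t *: (y - x))) -> connected_component A x y.
Proof.
move=> h; have := @connected_component_path _ A (fun t => x + t *: (y - x)).
rewrite scale0r addr0 scale1r [x + (y - x)]addrC subrK; apply => //.
by apply: continuous_subspaceT; exact: continuous_line.
Qed.

Lemma Ck_on_subset m n k (U U' : set 'rV[R]_m) (f : 'rV[R]_m -> 'rV[R]_n) :
  U' `<=` U -> Ck_on k U f -> Ck_on k U' f.
Proof.
move=> sU; elim: k f => [|k IH] f /=; first by move=> h x /sU; exact: h.
by move=> [h1 h2]; split=> [x /sU|v]; [exact: h1 | exact: IH].
Qed.

Lemma diffeo_restrict d (U W W' : set 'rV[R]_d) phi psi :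
  diffeo U W phi psi -> open W' -> W' `<=` W ->
  diffeo (U `&` phi @^-1` W') W' phi psi.
Proof.
move=> [[oU oW sphi spsi] [h1 h2]] oW' sW'; split; [split=> //|split].
- rewrite openE => x [Ux Wx]; apply: filterI; first exact: open_nbhs_nbhs.
  have /differentiable_continuous := (sphi 1%N).1 x Ux; apply.
  exact: open_nbhs_nbhs.
- by move=> k; apply: Ck_on_subset (sphi k); exact: subIsetl.
- by move=> k; apply: Ck_on_subset (spsi k).
- by move=> x [Ux Wx]; split=> //; exact: (h1 x Ux).2.
- by move=> y Wy; have [Uy phiy] := h2 y (sW' y Wy); split=> //; split=> //; rewrite /= phiy.
Qed.

(** Once the image of the chart is shrunk to a ball, the slice is convex, so the part of [S] in the
    chart lies in a single component. *)
Lemma submanifold_component d (S : set 'rV[R]_d.+1) p :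
  submanifold d S -> submanifold d (connected_component S p).
Proof.
move=> mS y Cy; have Sy := connected_component_sub Cy.
have [U [W [phi [psi [dfo Uy sl]]]]] := hypersurface_chart mS Sy.
have Wy := chart_in dfo Uy.
have [e e0 eW] := (nbhs_distP _ _).1 (chart_inv_nbhs dfo Wy).
pose B := [set z | dist z (phi y) < e].
have dfo' := diffeo_restrict dfo (@open_dist_lt _ (phi y) e) eW.
exists (U `&` phi @^-1` B), B, phi, psi; split=> //.
  by split=> //; rewrite /B /= distxx.
move=> x [Ux Bx]; have last0 : (forall i : 'I_d.+1, (d <= i)%N -> phi x 0 i = 0) <-> S x.
  rewrite sl //; split=> [|h i di]; first by apply.
  have -> // : i = ord_max.
  by apply/val_inj/eqP; rewrite eqn_leq /= di -ltnS ltn_ord.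
rewrite last0; split=> [/connected_component_sub //|Sx].
rewrite (same_connected_component Cy) //.
pose g := fun t : R => psi (phi y + t *: (phi x - phi y)).
have gB (t : R) : 0 <= t <= 1 -> B (phi y + t *: (phi x - phi y)).
  by move=> t01; apply: dist_segment_lt; rewrite // distxx.
have := @connected_component_path _ S g.
rewrite /g scale0r addr0 scale1r [phi y + (phi x - phi y)]addrC subrK.
rewrite (chartK dfo Uy) (chartK dfo Ux); apply.
  apply: continuous_in_subspaceT => t; rewrite inE /= in_itv /= => t01.
  have := differentiable_continuous (chart_inv_differentiable dfo (eW _ (gB t t01))).
  by apply: (continuous_comp (@continuous_line _ (phi y) (phi x - phi y) t)).
move=> t t01; have Wt := eW _ (gB t t01).
rewrite (sl _ (chart_inv_in dfo Wt)) (chart_invK dfo Wt) !mxE.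
by rewrite ((sl _ Ux).1 Sx) ((sl _ Uy).1 Sy) subrr mulr0 addr0.
Qed.

End Connected.

(** * Local side functions and their uniqueness *)

Section Sides.
Variables (R : realType) (d : nat) (S : set 'rV[R]_d.+1).
Local Notation V := 'rV[R]_d.+1.
Implicit Types (u v w x y z n a b o : V) (s : V -> bool).
Hypotheses (mS : submanifold d S) (clS : closed S).

(** A nonzero normal is not tangent, so the defining function has nonzero derivative along it and
    changes sign at [a]; [c] records the direction of the change. *)
Lemma chart_normal_sign (U W : set V) phi psi a n : @diffeo R d.+1 U W phi psi ->
  (forall x, U x -> (S x <-> phi x 0 ord_max = 0)) -> U a -> S a -> n != 0 ->
  normal_at S a n ->
  exists c : bool, exists2 e : R, 0 < e & forall t, 0 < t < e ->
    [/\ phi (a + t *: n) 0 ord_max != 0, phi (a - t *: n) 0 ord_max != 0,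
     (0 < phi (a + t *: n) 0 ord_max) = c & (0 < phi (a - t *: n) 0 ord_max) = ~~ c].
Proof.
move=> dfo sl Ua Sa n0 nn.
have fa : phi (a + 0 *: n) 0 ord_max = 0 by rewrite scale0r addr0; exact/(sl a Ua).
have fa' : phi (a + 0 *: - n) 0 ord_max = 0 by rewrite scale0r addr0; exact/(sl a Ua).
have h := chart_line_derive dfo n Ua.
have h' := chart_line_derive dfo (- n) Ua.
have c0 := chart_normal_transverse dfo sl Ua Sa n0 nn.
have [cn|cp|c0'] := ltrgtP (('d phi a n) 0 ord_max) 0; last by move/eqP: c0.
- have cn' : 0 < ('d phi a (- n)) 0 ord_max.
    have -> : ('d phi a (- n)) 0 ord_max = - ('d phi a n) 0 ord_max.
      by rewrite linearN mxE.
    by rewrite oppr_gt0.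
  have [e e0 he] := is_derive_pos_sign h' fa' cn'.
  exists false; exists e => // t te; have [] := he t te.
  rewrite scalerN scaleNr scalerN opprK => h1 h2.
  by split; [rewrite lt_eqF | rewrite gt_eqF | rewrite (lt_gtF h2) | rewrite h1].
- have [e e0 he] := is_derive_pos_sign h fa cp.
  exists true; exists e => // t te; have [] := he t te.
  rewrite scaleNr => h1 h2.
  by split; [rewrite gt_eqF | rewrite lt_eqF | rewrite h1 | rewrite (lt_gtF h2)].
Qed.

Lemma normal_exists a : S a -> exists2 n, n != 0 & normal_at S a n.
Proof.
move=> Sa; have [U [W [phi [psi [dfo Ua sl]]]]] := hypersurface_chart mS Sa.
exists (chart_grad phi a).
  have h := chart_grad_neq0 dfo Ua.
  exact h.
move=> v tv; exact: etrans (esym (chart_gradE phi a v)) ((tangent_vectorP dfo sl v Ua Sa).1 tv).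
Qed.

Lemma normal_off a n : S a -> n != 0 -> normal_at S a n ->
  exists2 e : R, 0 < e & forall t, 0 < t < e -> ~ S (a + t *: n) /\ ~ S (a - t *: n).
Proof.
move=> Sa n0 nn; have [U [W [phi [psi [dfo Ua sl]]]]] := hypersurface_chart mS Sa.
have [c [e e0 he]] := chart_normal_sign dfo sl Ua Sa n0 nn.
have [e' e'0 he'] := line_nbhs n (chart_nbhs dfo Ua).
exists (Num.min e e'); first by rewrite lt_min e0.
move=> t /andP[t0]; rewrite lt_min => /andP[te te'].
have [|/eqP h1 /eqP h2 _ _] := he t; first by rewrite t0.
have U1 : U (a + t *: n) by apply: he'; rewrite gtr0_norm.
have U2 : U (a - t *: n) by rewrite -scaleNr; apply: he'; rewrite normrN gtr0_norm.
by split=> /sl; [move/(_ U1)|move/(_ U2)].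
Qed.

(** A condition at one point, so that a side function on an open set is one satisfying it
    throughout. The values of [s] on [S] carry no information, as [sideat_germ] makes precise;
    flipping is tested along normals only, which are transverse to [S]. *)
Definition sideat s x :=
  (~ S x -> \forall y \near x, s y = s x) /\
  (S x -> forall n, n != 0 -> normal_at S x n ->
     exists2 e : R, 0 < e & forall t, 0 < t < e -> s (x + t *: n) != s (x - t *: n)).

Lemma offS_near x : ~ S x -> \forall y \near x, ~ S y.
Proof. by move=> nSx; apply: open_nbhs_nbhs; split=> //; exact: closed_openC. Qed.

Lemma sideat_germ s s' x : sideat s x ->
  (\forall y \near x, ~ S y -> s' y = s y) -> sideat s' x.
Proof.
move=> [h1 h2] ss'; split.
  move=> nSx; have e := nbhs_singleton ss' nSx.
  have nS := offS_near nSx; have hs := h1 nSx.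
  apply: filterS3 nS hs ss' => y nSy sy /(_ nSy) ->; by rewrite sy e.
move=> Sx n n0 nn; have [e1 e10 he1] := h2 Sx n n0 nn.
have [e2 e20 he2] := normal_off Sx n0 nn.
have [e3 e30 he3] := line_nbhs n ss'.
exists (Num.min e1 (Num.min e2 e3)); first by rewrite !lt_min e10 e20.
move=> t /andP[t0]; rewrite !lt_min => /and3P[t1 t2 t3].
have [|o1 o2] := he2 t; first by rewrite t0.
rewrite (he3 t) ?gtr0_norm //.
have := he3 (- t); rewrite normrN gtr0_norm // scaleNr => -> //.
by apply: he1; rewrite t0.
Qed.

Lemma sideat_addb s x (c : bool) : sideat s x -> sideat (fun y => s y (+) c) x.
Proof.
move=> [h1 h2]; split=> [nS|Sx n n0 nn]; first by apply: filterS (h1 nS) => y ->.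
have [e e0 he] := h2 Sx n n0 nn; exists e => // t /he.
by move: (s _) (s _) => [] []; case: c.
Qed.

Lemma sideat_exists x : exists s, \forall y \near x, sideat s y.
Proof.
have [Sx|nSx] := pselect (S x); last first.
  exists (fun=> true); apply: filterS (offS_near nSx) => y nSy; split=> // _.
  by near do by [].
have [U [W [phi [psi [dfo Ux sl]]]]] := hypersurface_chart mS Sx.
exists (fun y => 0 < phi y 0 ord_max).
apply: filterS (chart_nbhs dfo Ux) => y Uy; split.
  move=> nSy.
  have [dc _] := diff_coord 0 ord_max (chart_differentiable dfo Uy).
  have cc := differentiable_continuous dc.
  have : phi y 0 ord_max != 0 by apply/eqP => h; apply: nSy; exact/sl.
  move=> /lt_total/orP[lt|gt].
    have hlt : \forall z \near y, phi z 0 ord_max < 0 by exact: (@cvgr_lt _ _ _ _ _ _ cc 0 lt).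
    apply: filterS hlt => z /= zlt; apply/idP/idP => h; exfalso.
      by have := lt_trans h zlt; rewrite ltxx.
    by have := lt_trans h lt; rewrite ltxx.
  have hgt : \forall z \near y, 0 < phi z 0 ord_max by exact: (@cvgr_gt _ _ _ _ _ _ cc 0 gt).
  by apply: filterS hgt => z /= ->; rewrite gt.
move=> Sy n n0 nn; have [c [e e0 he]] := chart_normal_sign dfo sl Uy Sy n0 nn.
by exists e => // t /he[_ _ -> ->]; case: c {he}.
Unshelve. all: by end_near.
Qed.

(** [S] has empty interior: two constants describing the same function off [S] on overlapping
    neighbourhoods must therefore agree. *)
Lemma near_off x (A : set V) : nbhs x A -> exists2 y, A y & ~ S y.
Proof.
move=> Ax; have [Sx|nSx] := pselect (S x); last by exists x => //; exact: nbhs_singleton Ax.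
have [n n0 nn] := normal_exists Sx.
have [e e0 he] := normal_off Sx n0 nn.
have [e' e'0 he'] := line_nbhs n Ax.
pose t := Num.min e e' / 2.
have m0 : 0 < Num.min e e' by rewrite lt_min e0.
have t0 : 0 < t by rewrite divr_gt0.
have : t < Num.min e e' by rewrite /t; lra.
rewrite lt_min => /andP[te te'].
exists (x + t *: n); first by apply: he'; rewrite gtr0_norm.
by have [|] := he t; first rewrite t0.
Qed.

(* Near a point of S the complement of S has two sides, each the image of a half
   ball, so the ratio of two side functions, being constant on each side and the
   same across S, is constant off S. *)
Lemma sideat_rigid s1 s2 x :
  (\forall y \near x, sideat s1 y) -> (\forall y \near x, sideat s2 y) ->
  exists c : bool, \forall y \near x, ~ S y -> s1 y (+) s2 y = c.
Proof.
move=> h1 h2; pose r y := s1 y (+) s2 y.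
have rc y : sideat s1 y -> sideat s2 y -> ~ S y -> \forall z \near y, r z = r y.
  move=> [k1 _] [k2 _] nSy; apply: filterS2 (k1 nSy) (k2 nSy) => z.
  by rewrite /r => -> ->.
have [Sx|nSx] := pselect (S x); last first.
  exists (r x); apply: filterS (rc x (nbhs_singleton h1) (nbhs_singleton h2) nSx) => y.
  by [].
have [U [W [phi [psi [dfo Ux sl]]]]] := hypersurface_chart mS Sx.
have Wx := chart_in dfo Ux.
have cphi := differentiable_continuous (chart_differentiable dfo Ux).
have cpsi := differentiable_continuous (chart_inv_differentiable dfo Wx).
have [e e0 he] : exists2 e : R, 0 < e & forall z, dist z (phi x) < e ->
    [/\ W z, sideat s1 (psi z) & sideat s2 (psi z)].
  apply/nbhs_distP.
  have px A : nbhs x A -> nbhs (phi x) (psi @^-1` A).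
    by move=> Ax; apply: cpsi; rewrite (chartK dfo Ux).
  by apply: filterS3 (chart_inv_nbhs dfo Wx) (px _ h1) (px _ h2).
have half z z' : dist z (phi x) < e -> dist z' (phi x) < e ->
    0 < z 0 ord_max * z' 0 ord_max -> r (psi z) = r (psi z').
  move=> ze ze' zz'.
  pose L := fun t : R => z + t *: (z' - z).
  have LB (t : R) : 0 <= t <= 1 -> dist (L t) (phi x) < e by move=> t01; exact: dist_segment_lt.
  have Lne (t : R) : 0 <= t <= 1 -> ~ S (psi (L t)).
    move=> t01; have [Wt _ _] := he _ (LB t t01).
    rewrite (sl _ (chart_inv_in dfo Wt)) (chart_invK dfo Wt) !mxE => e0'.
    move: zz' e0' t01; move: (z 0 ord_max) (z' 0 ord_max) => p q pq e0' /andP[t0 t1].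
    have : 0 < (p + t * (q - p)) * p \/ 0 < (p + t * (q - p)) * q.
      have [p0 q0] : p != 0 /\ q != 0.
        by split; apply: contraTneq pq => ->; rewrite ?mul0r ?mulr0 ltxx.
      have [hp|hp] := leP t (1 / 2); [left|right].
        have -> : (p + t * (q - p)) * p = (1 - t) * p ^+ 2 + t * (p * q) by ring.
        apply: ltr_wpDr; first by rewrite mulr_ge0 // ltW.
        by apply: mulr_gt0; [lra | rewrite exprn_even_gt0].
      have -> : (p + t * (q - p)) * q = t * q ^+ 2 + (1 - t) * (p * q) by ring.
      apply: ltr_wpDr; first by rewrite mulr_ge0 ?subr_ge0 // ltW.
      by apply: mulr_gt0; [lra | rewrite exprn_even_gt0].
    by rewrite e0' !mul0r ltxx => -[].
  have := @connected_locally_constant R bool `[0, 1] (fun t => r (psi (L t))) (@segment_connected R 0 1).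
  move=> /(_ _ 0 1); rewrite /L scale0r addr0 scale1r [z + (z' - z)]addrC subrK; apply.
  - move=> t /=; rewrite in_itv /= => t01.
    have [Wt k1 k2] := he _ (LB t t01).
    have cp := differentiable_continuous (chart_inv_differentiable dfo Wt).
    have hn : \forall t' \near t, r (psi (L t')) = r (psi (L t)).
      exact: (@continuous_line _ _ z (z' - z) t _ (cp _ (rc _ k1 k2 (Lne t t01)))).
    by apply: filterS hn => t' /= ->.
  - by rewrite /= in_itv /= lexx ler01.
  - by rewrite /= in_itv /= lexx ler01.
have [n n0 nn] := normal_exists Sx.
have [c [e1 e10 he1]] := chart_normal_sign dfo sl Ux Sx n0 nn.
have [e2 e20 he2] := (nbhs_singleton h1).2 Sx n n0 nn.
have [e3 e30 he3] := (nbhs_singleton h2).2 Sx n n0 nn.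
have nB : nbhs x (U `&` [set y | dist (phi y) (phi x) < e]).
  by apply: filterI (chart_nbhs dfo Ux) (cphi _ (dist_nbhs (phi x) e0)).
have [e4 e40 he4] := line_nbhs n nB.
pose m := Num.min (Num.min e1 e2) (Num.min e3 e4).
have m0 : 0 < m by rewrite !lt_min e10 e20 e30.
pose t := m / 2.
have t0 : 0 < t by rewrite divr_gt0.
have : t < m by rewrite /t; lra.
rewrite !lt_min => /andP[/andP[t1 t2] /andP[t3 t4]].
have [|p0 q0 pc qc] := he1 t; first by rewrite t0.
have d2 := he2 t; rewrite t0 t2 in d2; have {}d2 := d2 isT.
have d3 := he3 t; rewrite t0 t3 in d3; have {}d3 := d3 isT.
have [Up Bp] : (U `&` [set y | dist (phi y) (phi x) < e]) (x + t *: n).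
  by apply: he4; rewrite gtr0_norm.
have [Uq Bq] : (U `&` [set y | dist (phi y) (phi x) < e]) (x - t *: n).
  by rewrite -scaleNr; apply: he4; rewrite normrN gtr0_norm.
have rpq : r (x + t *: n) = r (x - t *: n).
  by rewrite /r; move: d2 d3; case: (s1 _); case: (s1 _); case: (s2 _); case: (s2 _).
exists (r (x + t *: n)); apply: filterS nB => y [Uy By] nSy.
have y0 : phi y 0 ord_max != 0 by apply/eqP => h; apply: nSy; exact/sl.
rewrite -/(r y) -(chartK dfo Uy).
have sgn (p q : R) : p != 0 -> q != 0 -> (0 < p) = (0 < q) -> 0 < p * q.
  have [p0'|p0'|->] := ltrgtP p 0; have [q0'|q0'|->] := ltrgtP q 0; rewrite ?eqxx //.
  - by move=> _ _ _; rewrite nmulr_rgt0.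
  - by move=> _ _ _; rewrite mulr_gt0.
have [yc|yc] := eqVneq (0 < phi y 0 ord_max) c.
  rewrite -[in RHS](chartK dfo Up); apply: half => //.
  by apply: sgn => //; rewrite yc pc.
rewrite rpq -[in RHS](chartK dfo Uq); apply: half => //.
by apply: sgn => //; rewrite qc; move: yc; case: (0 < _); case: c {pc qc he1}.
Qed.

End Sides.

(** * Continuation of side functions and the separation theorem *)

Section Separation.
Variables (R : realType) (d : nat) (S : set 'rV[R]_d.+1).
Local Notation V := 'rV[R]_d.+1.
Implicit Types (u v w x y z n a b o : V) (s : V -> bool).
Hypotheses (mS : submanifold d S) (clS : closed S).

Lemma sideat_rigid_segment s1 s2 o v :
  (forall t : R, 0 <= t <= 1 -> \forall y \near o + t *: v, sideat S s1 y) ->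
  (forall t : R, 0 <= t <= 1 -> \forall y \near o + t *: v, sideat S s2 y) ->
  exists c : bool, forall t : R, 0 <= t <= 1 ->
    \forall y \near o + t *: v, ~ S y -> s1 y (+) s2 y = c.
Proof.
move=> h1 h2.
have ex (t : R) : exists c : bool, 0 <= t <= 1 ->
    \forall y \near o + t *: v, ~ S y -> s1 y (+) s2 y = c.
  have [t01|nt] := pselect (0 <= t <= 1); last by exists true.
  by have [c hc] := sideat_rigid mS (h1 t t01) (h2 t t01); exists c.
have [c hc] := choice ex.
have c01 : forall x y : R, `[0, 1]%classic x -> `[0, 1]%classic y -> c x = c y.
  apply: (connected_locally_constant (@segment_connected R 0 1)) => t.
  rewrite /= in_itv /= => t01.
  have hn : \forall t' \near t, \forall y \near o + t' *: v, ~ S y -> s1 y (+) s2 y = c t.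
    exact: (@continuous_line _ _ o v t _ (nbhs_interior (hc t t01))).
  apply: filterS hn => t' ht'; rewrite in_itv /= => /hc ht2.
  have [y [e1 e2] nSy] := near_off mS (filterI ht' ht2).
  by rewrite -e1 // -e2.
exists (c 0) => t t01; rewrite (c01 0 t); first exact: hc.
  by rewrite /= in_itv /= lexx ler01.
by rewrite /= in_itv.
Qed.

(** Space is cut by the hyperplane through [o + t *: v] orthogonal to [v]. Near the cut point [s2],
    corrected by the constant [c] of [sideat_rigid], agrees with [s1] off [S], so the cut is
    invisible there. *)
Lemma sideat_glue s1 s2 o v (t t' : R) : v != 0 -> 0 <= t -> t <= t' ->
  (forall u : R, 0 <= u <= t -> \forall y \near o + u *: v, sideat S s1 y) ->
  (forall u : R, t <= u <= t' -> \forall y \near o + u *: v, sideat S s2 y) ->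
  exists s, forall u : R, 0 <= u <= t' -> \forall y \near o + u *: v, sideat S s y.
Proof.
move=> v0 t0 tt' h1 h2.
have h1t : \forall y \near o + t *: v, sideat S s1 y by apply: h1; rewrite t0 lexx.
have h2t : \forall y \near o + t *: v, sideat S s2 y by apply: h2; rewrite lexx tt'.
have [c hc] := sideat_rigid mS h1t h2t.
pose h y := dotp y v; pose k := dotp (o + t *: v) v.
have hu (u : R) : h (o + u *: v) - k = (u - t) * dotp v v.
  by rewrite /h /k !dotpE; ring.
have vv : 0 < dotp v v by rewrite dotp_gt0.
have ch : continuous h by exact: dotp_continuousl.
exists (fun y => if h y < k then s1 y else s2 y (+) c) => u /andP[u0 ut'].
have [ut|tu|ut] := ltrgtP u t.
- have lt : h (o + u *: v) < k.
    by rewrite -subr_lt0 hu nmulr_rlt0 // subr_lt0.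
  have near_lt : \forall y \near o + u *: v, h y < k by exact: (@cvgr_lt _ _ _ _ _ _ (ch _) _ lt).
  have h1u : \forall y \near o + u *: v, sideat S s1 y by apply: h1; rewrite u0 ltW.
  apply: filterS2 h1u (nbhs_interior near_lt) => y sy hy.
  apply: (sideat_germ mS clS sy); apply: filterS hy => z hz _; by rewrite hz.
- have lt : k < h (o + u *: v).
    by rewrite -subr_gt0 hu pmulr_rgt0 // subr_gt0.
  have near_lt : \forall y \near o + u *: v, k < h y by exact: (@cvgr_gt _ _ _ _ _ _ (ch _) _ lt).
  have h2u : \forall y \near o + u *: v, sideat S s2 y by apply: h2; rewrite ut' ltW.
  apply: filterS2 h2u (nbhs_interior near_lt) => y sy hy.
  apply: (sideat_germ mS clS (sideat_addb c sy)); apply: filterS hy => z hz _.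
  by rewrite ltNge ltW.
- rewrite ut; apply: filterS2 h1t (nbhs_interior hc) => y sy hy.
  apply: (sideat_germ mS clS sy); apply: filterS hy => z hz /hz <-.
  by case: ifP => // _; rewrite addbC addbK.
Qed.

(** The parameters up to which a side function exists have a supremum; a local side function there,
    glued to one that nearly reaches it, goes beyond, unless the end 1 is attained. *)
Lemma sideat_segment o v :
  exists s, forall t : R, 0 <= t <= 1 -> \forall y \near o + t *: v, sideat S s y.
Proof.
have [->|v0] := eqVneq v 0.
  have [s hs] := sideat_exists mS clS o; exists s => t _.
  by rewrite scaler0 addr0.
pose good (t : R) := exists s, forall u : R, 0 <= u <= t -> \forall y \near o + u *: v, sideat S s y.
pose T := [set t : R | 0 <= t <= 1 /\ good t].
have T0 : T 0.
  split; first by rewrite lexx ler01.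
  have [s hs] := sideat_exists mS clS o; exists s => u u0.
  have -> : u = 0 by apply/eqP; rewrite eq_le andbC.
  by rewrite scale0r addr0.
have ubT : ubound T 1 by move=> t [/andP[]].
have sT : has_sup T by split; [exists 0 | exists 1].
have s1 : sup T <= 1 by apply: ge_sup => //; exists 0.
have [s2 hs2] := sideat_exists mS clS (o + sup T *: v).
have [r r0 hr] := (nbhs_distP _ _).1 hs2.
have v1 : 0 < enorm v by rewrite enorm_gt0.
(* A parameter change below [e] moves the point by less than [r], so the stretch from [t] to [t']
   stays in the ball on which [s2] is a side function. *)
pose e := r / enorm v; have e0 : 0 < e by rewrite divr_gt0.
have [t Tt ht] := sup_adherent e0 sT.
have ts : t <= sup T by apply: ub_le_sup => //; exists 1.
have [/andP[t0 t1] [s1' hs1]] := Tt.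
pose t' := Num.min 1 (sup T + e / 2).
have t's : t' <= sup T + e / 2 by rewrite ge_min lexx orbT.
have t'1 : t' <= 1 by rewrite ge_min lexx.
have tt' : t <= t' by rewrite le_min t1 /=; lra.
have Tt' : T t'.
  split; first by rewrite (le_trans t0).
  apply: (sideat_glue v0 t0 tt' hs1) => u /andP[tu ut'].
  apply/nbhs_distP; exists (r - `|u - sup T| * enorm v).
    rewrite subr_gt0 -ltr_pdivlMr // -/e ltr_norml; apply/andP; split; lra.
  move=> y hy; apply: hr; have := dist_triangle (o + u *: v) y (o + sup T *: v).
  rewrite dist_ray2; lra.
have t's' : t' <= sup T by apply: ub_le_sup => //; exists 1.
have t'E : t' = 1.
  apply/eqP; rewrite eq_le t'1 /= leNgt; apply/negP => lt.
  have : t' = sup T + e / 2.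
    by move: lt; rewrite /t'; case: (leP 1 (sup T + e / 2)) => //; rewrite ltxx.
  by lra.
by case: Tt' => _; rewrite t'E.
Qed.

(** The tube lemma for the compact segment; a tube of constant width contains the segments towards
    all endpoints close to [o + v]. *)
Lemma sideat_segment_unif s o v :
  (forall t : R, 0 <= t <= 1 -> \forall y \near o + t *: v, sideat S s y) ->
  exists2 r : R, 0 < r & forall t y, 0 <= t <= 1 -> dist y (o + t *: v) < r -> sideat S s y.
Proof.
move=> hs.
have := (compact_near_coveringP (`[0, 1]%classic : set R)).1 (@segment_compact R 0 1).
move=> /(_ R (0^'+) (fun r t => forall y, dist y (o + t *: v) < r -> sideat S s y)).
have cov : forall t : R, `[0, 1]%classic t -> \forall t' \near t & r \near (0 : R)^'+,
    forall y, dist y (o + t' *: v) < r -> sideat S s y.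
  move=> t; rewrite /= in_itv /= => t01.
  have [e e0 he] := (nbhs_distP _ _).1 (hs t t01).
  have e2 : 0 < e / 2 by rewrite divr_gt0.
  exists ([set t' | dist (o + t' *: v) (o + t *: v) < e / 2], [set r : R | r < e / 2]).
    split; first exact: (@continuous_line _ _ o v t _ (dist_nbhs (o + t *: v) e2)).
    exact: nbhs_right_lt.
  move=> [t' r] /= [ht' hr] y hy; apply: he.
  by have := dist_triangle (o + t' *: v) y (o + t *: v); lra.
move=> /(_ _ cov) h.
have [r [r0 hr]] := filter_ex (filterI (nbhs_right_gt (0 : R)) h).
exists r => // t y t01; apply: (hr t).
by rewrite /= in_itv.
Qed.

(* Side functions continue uniquely along the segments issued from a base point,
   and R^d is star-shaped: hence a global one. *)
Lemma sideat_global : exists s, forall x, sideat S s x.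
Proof.
have [z0 _ nSo] : exists2 z0, setT z0 & ~ S z0 by apply: (@near_off _ _ _ mS 0); exact: filterT.
have norm_side x : exists s, s z0 = true /\
    forall t : R, 0 <= t <= 1 -> \forall y \near z0 + t *: (x - z0), sideat S s y.
  have [s hs] := sideat_segment z0 (x - z0).
  exists (fun y => s y (+) ~~ s z0); split; first by rewrite addbN addbb.
  by move=> t t01; apply: filterS (hs t t01) => y; exact: sideat_addb.
have [f hf] := choice norm_side.
exists (fun x => f x x) => x; have [fxo hx] := hf x.
have h1 : (0 : R) <= 1 <= (1 : R) by rewrite ler01 lexx.
have h0 : (0 : R) <= 0 <= (1 : R) by rewrite ler01 lexx.
have oneE z : z0 + 1 *: (z - z0) = z by rewrite scale1r addrC subrK.
have sx : sideat S (f x) x by have := hx 1 h1; rewrite oneE => /nbhs_singleton.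
(* It remains to see that [f y y = f x y] for [y] near [x] off [S]. The segment from [z0] to [y]
   lies in the tube where [f x] is a side function, so [f x] and [f y] differ by a constant along
   it, and they agree at [z0]. *)
apply: (sideat_germ mS clS sx).
have [r r0 hr] := sideat_segment_unif hx.
apply/nbhs_distP; exists r => // y yr nSy; have [fyo hy] := hf y.
have [|c hc] := @sideat_rigid_segment (f x) (f y) z0 (y - z0) _ hy.
  move=> t t01; apply/nbhs_distP; exists (r - dist y x); first by rewrite subr_gt0.
  move=> z hz; apply: (hr t z t01).
  have := dist_triangle (z0 + t *: (y - z0)) z (z0 + t *: (x - z0)).
  have : dist (z0 + t *: (y - z0)) (z0 + t *: (x - z0)) <= dist y x.
    have -> : dist (z0 + t *: (y - z0)) (z0 + t *: (x - z0)) = enorm (t *: (y - x)).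
      by congr enorm; apply/rowP => i; rewrite !mxE; ring.
    by case/andP: t01 => t0 t1; rewrite enormZ ger0_norm // ler_piMl ?enorm_ge0.
  by lra.
have c0 : c = false.
  have := hc 0 h0; rewrite scale0r addr0 => /nbhs_singleton /(_ nSo) <-.
  by rewrite fxo fyo.
have := hc 1 h1; rewrite oneE => /nbhs_singleton /(_ nSy).
by rewrite c0; case: (f x y); case: (f y y).
Qed.

Lemma sideat_component s x y : (forall x, sideat S s x) ->
  connected_component (~` S) x y -> s x = s y.
Proof.
move=> hs Cxy.
have Sx : (~` S) x.
  by apply: contrapT => nx; move: Cxy; rewrite connected_component_out.
apply: (@connected_locally_constant _ bool (connected_component (~` S) x) s) => //.
- exact: component_connected.
- move=> z /connected_component_sub nSz.
  by apply: filterS ((hs z).1 nSz) => w ->.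
- exact: connected_component_refl.
Qed.

Hypothesis d1 : (1 <= d)%N.
Hypothesis cS : compact S.

(** Beyond a cube containing [S], space is covered by the half spaces where some coordinate exceeds
    [M] in absolute value with a given sign. Each is convex and misses [S], and consecutive ones
    overlap. *)
Lemma sideat_infinity s : (forall x, sideat S s x) ->
  exists c : bool, forall x, outside S x -> s x = c.
Proof.
move=> hs.
have [M0 [_ hM0]] := compact_bounded cS.
pose M := Num.max 0 (M0 + 1).
have M00 : 0 <= M by rewrite le_max lexx.
have hM x : S x -> `|x| <= M.
  by apply: (hM0 M); rewrite lt_max ltrDl ltr01 orbT.
have half x y i (c : R) : `|c| = 1 -> M < c * x 0 i -> M < c * y 0 i -> s x = s y.
  move=> c1 xi yi; apply: sideat_component => //.
  apply: connected_component_segment => t /andP[t0 t1] St.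
  have := le_trans (normr_coord_le _ i) (hM _ St).
  rewrite -[X in X <= _]mul1r -c1 -normrM !mxE => h.
  have := le_trans (ler_norm _) h.
  move: (x 0 i) (y 0 i) xi yi {h} => p q xi yi.
  have -> : c * (p + t * (q - p)) = (1 - t) * (c * p) + t * (c * q) by ring.
  move: (c * p) (c * q) xi yi => p' q' xi yi.
  have h1 : t * M <= t * q' by rewrite ler_wpM2l // ltW.
  have h2 : (1 - t) * M <= (1 - t) * p' by rewrite ler_wpM2l ?subr_ge0 // ltW.
  have [t0'|t0'] := eqVneq t 0; first by rewrite t0' subr0 mul0r addr0 mul1r leNgt xi.
  have h3 : t * M < t * q' by rewrite ltr_pM2l // lt_neqAle eq_sym t0'.
  lra.
pose a : V := const_mx (M + 1).
pose b : V := const_mx (- (M + 1)).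
have i1 : (1 < d.+1)%N by [].
(* [w] shares a positive half space with the corner [a] and a negative one with the opposite corner
   [b]. Two coordinates are required here: on a line the two ends are not joined. *)
pose w : V := \row_i if i == ord0 then M + 1 else - (M + 1).
have aw : s a = s w.
  apply: (@half _ _ ord0 1); rewrite ?normr1 // !mxE ?eqxx mul1r; lra.
have wb : s w = s b.
  by apply: (@half _ _ (Ordinal i1) (- 1)); rewrite ?normrN1 // !mxE /= mulN1r; lra.
have far x : M < `|x| -> s x = s a.
  move=> xM; have [i hi] : exists i, M < `|x 0 i|.
    apply: contrapT => h; move: xM; rewrite ltNge => /negP; apply.
    apply: ler_norm_coord => // i; rewrite leNgt; apply/negP => hi; apply: h.
    by exists i.
  have [xi|xi] := leP 0 (x 0 i).
    rewrite ger0_norm // in hi.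
    by apply: (@half _ _ i 1); rewrite ?normr1 // ?mul1r // mxE; lra.
  rewrite ltr0_norm // in hi.
  by rewrite aw wb; apply: (@half _ _ i (- 1)); rewrite ?normrN1 // ?mulN1r // mxE; lra.
exists (s a) => x outx.
have [y Cy My] : exists2 y, connected_component (~` S) x y & M < `|y|.
  apply: contrapT => h; apply: outx; exists M; split; first by rewrite num_real.
  move=> M' MM' y Cy; apply: le_trans (ltW MM'); rewrite leNgt; apply/negP => hy.
  by apply: h; exists y.
by rewrite (sideat_component hs Cy) far.
Qed.

(** A side function has one value on all of the outside, yet differs at [a + t *: n] and
    [a - t *: n]. *)
Lemma outside_one_side a n : S a -> n != 0 -> normal_at S a n ->
  exists2 e : R, 0 < e & forall t, 0 < t < e ->
    ~ (outside S (a + t *: n) /\ outside S (a - t *: n)).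
Proof.
move=> Sa n0 nn; have [s hs] := sideat_global.
have [c hc] := sideat_infinity hs.
have [e e0 he] := (hs a).2 Sa n n0 nn.
by exists e => // t /he + [out1 out2]; rewrite (hc _ out1) (hc _ out2) eqxx.
Qed.

End Separation.

(** * Tangent balls *)

Section Geometry.
Variables (R : realType) (d : nat) (S : set 'rV[R]_d.+1).
Local Notation V := 'rV[R]_d.+1.
Implicit Types (u v w x y z n m a b p q : V).
Hypotheses (mS : submanifold d S) (cS : compact S) (d1 : (1 <= d)%N).

Lemma lfs_le p x : medial_axis S x -> lfs S p <= dist p x.
Proof.
move=> Mx; apply: ge_inf; last by exists x.
by exists 0 => _ [y _ <-]; exact: dist_ge0.
Qed.

Lemma near_notin_medial_axis p x : dist x p < lfs S p -> ~ medial_axis S x.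
Proof. by rewrite distC => lt /(lfs_le p); rewrite leNgt lt. Qed.

Lemma nearest_self p a : S p -> nearest S p a -> a = p.
Proof.
move=> Sp [_ /(_ _ Sp)]; rewrite distxx => h.
by apply/eqP; rewrite eq_sym -dist_eq0 eq_le h dist_ge0.
Qed.

(* The nearest-point projection is continuous on the segment from p to q, which
   it maps into one component. *)
Lemma near_same_component p q : S p -> S q -> dist p q < lfs S p ->
  connected_component S p q.
Proof.
move=> Sp Sq pq.
have [xi nxi] := choice (fun x => nearest_exists cS x (ex_intro _ p Sp)).
pose L t := p + t *: (q - p).
have Ln (t : R) : 0 <= t <= 1 -> ~ medial_axis S (L t).
  move=> /andP[t0 t1]; apply: (@near_notin_medial_axis p); apply: le_lt_trans pq.
  rewrite /L dist_ray ger0_norm // -/(dist q p) distC ler_piMl ?dist_ge0 //.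
have := @connected_component_path R _ S (fun t => xi (L t)).
rewrite /L scale0r addr0 scale1r [p + (q - p)]addrC subrK.
rewrite (nearest_self Sp (nxi p)) (nearest_self Sq (nxi q)); apply; last first.
  by move=> t _; exact: (nxi _).1.
apply: continuous_in_subspaceT => t; rewrite inE /= in_itv /= => t01.
move=> A /nbhs_distP[e e0 eA].
have [r r0 uni] := nearest_unique_nbhd (Ln t t01).
have [|s s0 hs] := @nearest_continuous _ _ _ cS (L t) (xi (L t)) e _ e0.
  by move=> b nb; apply: (uni (L t)); rewrite ?distxx.
have hn : \forall t' \near t, dist (L t') (L t) < s.
  exact: (@continuous_line _ _ p (q - p) t _ (dist_nbhs (L t) s0)).
by apply: filterS hn => t' ht'; apply: eA; exact: hs ht' (nxi _).
Qed.

Lemma nearest_normal_radius p n (r : R) : S p -> n != 0 -> normal_at S p n -> 0 < r ->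
  (forall t, 0 < t < r -> ~ medial_axis S (p + t *: n)) -> nearest S (p + r *: n) p.
Proof.
move=> Sp n0 nn r0 hM.
have [t t0 nt] := nearest_along_normal mS cS Sp n0 nn.
have [tr|rt] := leP t r.
  by apply: (@nearest_ray _ _ _ cS p n t r) => //; rewrite t0.
by apply: nearest_between nt; rewrite !ltW.
Qed.

Lemma outside_connected (C : set V) x y : outside C x ->
  connected_component (~` C) x y -> outside C y.
Proof. by rewrite /outside /= => ux /same_connected_component <-. Qed.

Lemma ball_outside (C : set V) c (r : R) x y :
  (forall z, dist z c < r -> ~ C z) -> dist x c < r -> dist y c < r ->
  outside C x -> outside C y.
Proof.
move=> hC xr yr ox'; apply: (outside_connected ox').
apply: connected_component_segment => t t01; apply: hC; exact: dist_segment_lt.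
Qed.

Lemma nearest_ball p n (r : R) z : enorm n = 1 -> 0 < r ->
  nearest S (p + r *: n) p -> dist z (p + r *: n) < r -> ~ S z.
Proof.
move=> n1 r0 [_ h] zr Sz; have := h z Sz.
by rewrite dist_ray n1 mulr1 gtr0_norm // distC leNgt zr.
Qed.

Lemma ball_near p n (r t : R) : enorm n = 1 -> 0 < t < r ->
  dist (p + t *: n) (p + r *: n) < r.
Proof.
by move=> n1 /andP[t0 tr]; rewrite dist_ray2 n1 mulr1 ltr0_norm ?subr_lt0 //; lra.
Qed.

Lemma component_normal p q n : normal_at S q n -> normal_at (connected_component S p) q n.
Proof.
move=> nn v [g [g0 Cg dg]]; apply: nn; exists g; split=> //.
by apply: filterS Cg => t /connected_component_sub.
Qed.

(** Separation is used for the component of [q], itself a compact hypersurface, since outwardness is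
    measured against that component alone. *)
Lemma inner_not_outside q m : S q -> outward_normal S q m ->
  exists2 e : R, 0 < e & forall t, 0 < t < e ->
    outside (connected_component S q) (q + t *: m) /\
    ~ outside (connected_component S q) (q - t *: m).
Proof.
move=> Sq [m0 nm om].
have clS : closed S by apply: compact_closed => //; exact: norm_hausdorff.
have cC : compact (connected_component S q).
  apply: (subclosed_compact _ cS); first exact: component_closed.
  exact: connected_component_sub.
have [e1 e10 he1] := @outside_one_side _ _ _ (submanifold_component mS)
  (component_closed clS) d1 cC q m (connected_component_refl Sq) m0
  (component_normal nm).
have /nbhs_ballP[e2 /= e20 he2] := om.
exists (Num.min e1 e2); first by rewrite lt_min e10.
move=> t /andP[t0]; rewrite lt_min => /andP[t1 t2].
have h : outside (connected_component S q) (q + t *: m).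
  by apply: he2 => //; rewrite -ball_normE /ball_ /= sub0r normrN gtr0_norm.
by split=> // h'; apply: (he1 t) => //; rewrite t0.
Qed.

(** Overlapping balls would form a connected set missing [S] that joins the outside just above [p]
    to the inner side just below [q]. *)
Lemma tangent_balls_disjoint p q n m (r s : R) : S p -> S q ->
  connected_component S p q ->
  outward_normal S p n -> outward_normal S q m -> enorm n = 1 -> enorm m = 1 ->
  0 < r -> 0 < s -> nearest S (p + r *: n) p -> nearest S (q - s *: m) q ->
  r + s <= dist (p + r *: n) (q - s *: m).
Proof.
move=> Sp Sq Cpq onp onq n1 m1 r0 s0 np nq; rewrite leNgt; apply/negP => lt.
set c1 := p + r *: n in np lt; set c2 := q - s *: m in nq lt.
have rs0 : 0 < r + s by rewrite addr_gt0.
(* [z] divides the segment of centers in the ratio [r : s], so it lies in both open balls when the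
   centers are closer than [r + s]. *)
pose k := r / (r + s); pose z := c1 + k *: (c2 - c1).
have k0 : 0 <= k by rewrite divr_ge0 ?ltW.
have k1 : 1 - k = s / (r + s) by rewrite /k; field; rewrite gt_eqF.
have zc1 : dist z c1 < r.
  rewrite dist_ray ger0_norm // -/(dist c2 c1) distC /k mulrAC ltr_pdivrMr //.
  by rewrite ltr_pM2l.
have zc2 : dist z c2 < s.
  have -> : dist z c2 = enorm ((1 - k) *: (c1 - c2)).
    by congr enorm; apply/rowP => i; rewrite !mxE; ring.
  rewrite enormZ k1 ger0_norm ?divr_ge0 ?ltW // -/(dist c1 c2) mulrAC ltr_pdivrMr //.
  by rewrite ltr_pM2l.
have sub x : connected_component S p x -> S x by exact: connected_component_sub.
have [e e0 he] := inner_not_outside Sp onp.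
have [e' e'0] := inner_not_outside Sq onq.
rewrite -(same_connected_component Cpq) => he'.
have pick (a b : R) : 0 < a -> 0 < b -> exists2 t, 0 < t < a & 0 < t < b.
  move=> a0 b0; have m0 : 0 < Num.min a b by rewrite lt_min a0.
  have : Num.min a b / 2 < Num.min a b by lra.
  rewrite lt_min => /andP[h1 h2].
  by exists (Num.min a b / 2); rewrite divr_gt0.
have [t tr te] := pick _ _ r0 e0.
have oz : outside (connected_component S p) z.
  apply: (@ball_outside _ c1 r (p + t *: n)) zc1 (he t te).1.
    by move=> x xr /sub; exact: (nearest_ball n1 r0 np xr).
  exact: ball_near.
have [t' tr' te'] := pick _ _ s0 e'0.
have nq' : nearest S (q + s *: - m) q by rewrite scalerN.
have m1' : enorm (- m) = 1 by rewrite enormN.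
apply: (he' t' te').2; rewrite -scalerN.
apply: (@ball_outside _ c2 s z) zc2 _ oz.
  move=> x; rewrite /c2 -scalerN => xr /sub; exact: (nearest_ball m1' s0 nq' xr).
by rewrite /c2 -scalerN; exact: ball_near.
Qed.

(* Otherwise the inner tangent balls at p would grow forever. *)
Lemma medial_axis_neq0 p n : S p -> outward_normal S p n -> medial_axis S !=set0.
Proof.
move=> Sp onp; apply: contrapT => M0.
have [n0 nn _] := onp.
have [e e0 he] := inner_not_outside Sp onp.
pose t := e / 2; have t0 : 0 < t by rewrite divr_gt0.
have [|_] := he t; first by rewrite t0 /t; lra.
apply=> -[K [_ hK]].
have n0' : - n != 0 by rewrite oppr_eq0.
have nn' : normal_at S p (- n) by move=> v /nn; rewrite dotpNl => ->; rewrite oppr0.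
have n1 : 0 < `|n| by rewrite normr_gt0.
have off (s : R) : 0 < s -> ~ S (p - s *: n).
  move=> s0 Ss; rewrite -scalerN in Ss.
  have ns : nearest S (p + s *: - n) p.
    by apply: nearest_normal_radius => // u _ Mu; apply: M0; exists (p + u *: - n).
  have := nearest_self Ss ns => /eqP.
  rewrite -subr_eq0 opprD addrA subrr sub0r oppr_eq0 scaler_eq0 gt_eqF //=.
  by rewrite (negPf n0').
pose K' := Num.max K 0 + 1.
have KK' : K < K' by rewrite /K' ltr_pwDr // le_max lexx.
(* Chosen so that [p - s *: n] has norm above [K'], although the inner ray joins it to [p - t *: n]
   without meeting [S]. *)
pose s := t + (K' + `|p| + 1) / `|n|.
have K'0 : 0 < K' by rewrite /K' ltr_wpDl // le_max lexx orbT.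
have st : t < s by rewrite /s ltrDl divr_gt0 //; have := normr_ge0 p; lra.
have : `|p - s *: n| <= K'.
  apply: (hK K' KK'); apply: connected_component_segment => u /andP[u0 u1].
  have -> : p - t *: n + u *: (p - s *: n - (p - t *: n)) = p - (t + u * (s - t)) *: n.
    by apply/rowP => i; rewrite !mxE; ring.
  move=> /connected_component_sub; apply: off.
  by rewrite ltr_pwDl // mulr_ge0 // subr_ge0 ltW.
have : s * `|n| - `|p| <= `|p - s *: n|.
  rewrite -[X in X * _](gtr0_norm (lt_trans t0 st)) -normrZ distrC; exact: lerB_dist.
have : s * `|n| = t * `|n| + (K' + `|p| + 1) by rewrite /s; field; rewrite gt_eqF.
have := mulr_gt0 t0 n1; lra.
Qed.

(** The infimum of the empty set is 0 by convention, so a point of the medial axis is needed besides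
    the fact that [p] is off this closed set. *)
Lemma lfs_gt0 p n : S p -> outward_normal S p n -> 0 < lfs S p.
Proof.
move=> Sp onp; have [x Mx] := medial_axis_neq0 Sp onp.
have nM := notin_medial_axis mS Sp.
have : nbhs p (~` medial_axis S).
  by apply: open_nbhs_nbhs; split=> //; apply: closed_openC; exact: closed_closure.
move=> /nbhs_distP[e e0 he]; apply: lt_le_trans e0 _.
apply: lb_le_inf; first by exists (dist p x), x.
move=> _ [y My <-]; rewrite leNgt distC; apply/negP => /he; exact.
Qed.

Lemma distset_tangent_space p q n : S p -> enorm n = 1 -> normal_at S p n ->
  distset q (tangent_space S p) = `|dotp (q - p) n|.
Proof.
move=> Sp n1 nn; have n0 : n != 0 by rewrite -enorm_gt0 n1.
have [U [W [phi [psi [dfo Up sl]]]]] := hypersurface_chart mS Sp.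
set b := dotp (q - p) n.
have tv : tangent_vector S p (q - p - b *: n).
  apply: (tangent_orthogonal dfo sl Up Sp n0 nn).
  by rewrite dotpDr dotpNr dotpZr -sqr_enorm n1 expr1n mulr1 /b (dotpC n) subrr.
apply/eqP; rewrite eq_le; apply/andP; split.
  apply: ge_inf; first by exists 0 => _ [y _ <-]; exact: dist_ge0.
  exists (p + (q - p - b *: n)); first by exists (q - p - b *: n).
  have -> : dist q (p + (q - p - b *: n)) = enorm (b *: n).
    by congr enorm; apply/rowP => i; rewrite !mxE; ring.
  by rewrite enormZ n1 mulr1.
apply: lb_le_inf; first by exists (dist q (p + (q - p - b *: n))), (p + (q - p - b *: n)) => //; exists (q - p - b *: n).
move=> _ [_ [v tv' <-] <-].
have -> : b = dotp (q - (p + v)) n.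
  have -> : q - (p + v) = (q - p) - v by rewrite opprD addrA.
  by rewrite dotpDl dotpNl (dotpC v) nn // subr0.
by apply: le_trans (normr_dotp_le _ _) _; rewrite n1 mulr1.
Qed.

(* The medial axis stays outside the ball of radius [lfs S p] around p, so the
   tangent balls at q may grow until their centers leave it. With
   [a = (q - p).m], the two exit radii are [sqrt (a^2 + L^2 - D^2) -+ a]. *)
Lemma normal_variation p q n m : S p -> S q ->
  outward_normal S p n -> outward_normal S q m -> enorm n = 1 -> enorm m = 1 ->
  dist p q < lfs S p ->
  let L := lfs S p in let D := dist p q in let b := dotp (p - q) n in
  `|2 * L * b| <= D ^+ 2 /\
  exists ri ro : R, [/\ 0 < ri, 0 < ro, ri * ro = L ^+ 2 - D ^+ 2,
    2 * L * ri * (1 - dotp n m) + ri ^+ 2 <= L ^+ 2 + 2 * L * b &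
    2 * L * ro * (1 - dotp n m) + ro ^+ 2 <= L ^+ 2 - 2 * L * b].
Proof.
move=> Sp Sq onp onq n1 m1 pq L D b.
have L0 : 0 < L by exact: lfs_gt0 Sp onp.
have D0 : 0 <= D by exact: dist_ge0.
have Cpq := near_same_component Sp Sq pq.
have Cqp : connected_component S q p by exact: connected_component_sym.
have [n0 nn _] := onp; have [m0 nm _] := onq.
have oppn0 x : x != 0 -> - x != 0 by rewrite oppr_eq0.
have oppn x y : normal_at S x y -> normal_at S x (- y).
  by move=> h v /h; rewrite dotpNl => ->; rewrite oppr0.
have ball_p k : enorm k = 1 -> k != 0 -> normal_at S p k -> nearest S (p + L *: k) p.
  move=> k1 k0 nk; apply: nearest_normal_radius => // t /andP[t0 tL].
  by apply: (@near_notin_medial_axis p); rewrite dist_ray k1 mulr1 gtr0_norm.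
have Bp := ball_p n n1 n0 nn.
have Bp' := ball_p (- n) (etrans (enormN n) n1) (oppn0 _ n0) (oppn _ _ nn).
have DE : D ^+ 2 = dotp (p - q) (p - q) by rewrite /D sqr_dist.
set a := dotp (q - p) m.
pose s := Num.sqrt (a ^+ 2 + (L ^+ 2 - D ^+ 2)).
have LD : 0 < L ^+ 2 - D ^+ 2 by rewrite subr_gt0 (ltr_pXn2r (n := 2)) ?nnegrE // ltW.
have s2 : s ^+ 2 = a ^+ 2 + (L ^+ 2 - D ^+ 2) by rewrite sqr_sqrtr // addr_ge0 ?sqr_ge0 ?ltW.
have s0 : 0 <= s by exact: sqrtr_ge0.
have [sa1 sa2] : - s < a /\ a < s.
  apply/andP; rewrite -ltr_norml -(ltr_pXn2r (n := 2)) ?nnegrE //.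
  by rewrite real_normK ?num_real // s2 ltrDl.
(* Both sides of [q] at once: [k = m], [c = a] for the outer ball and [k = - m], [c = - a] for the
   inner one. Completing the square, [q + t *: k] is within [L] of [p] exactly when
   [(t + c) ^+ 2 < s ^+ 2]. *)
have ball_q k c : enorm k = 1 -> k != 0 -> normal_at S q k -> c = dotp (q - p) k ->
    - s < c -> c < s -> c ^+ 2 = a ^+ 2 -> nearest S (q + (s - c) *: k) q.
  move=> k1 k0 nk ck c1 c2 ca; apply: nearest_normal_radius => //; first by rewrite subr_gt0.
  move=> t /andP[t0 ts]; apply: (@near_notin_medial_axis p).
  rewrite -(ltr_pXn2r (n := 2)) ?nnegrE ?dist_ge0 ?(ltW L0) //.
  have -> : dist (q + t *: k) p ^+ 2 = D ^+ 2 + 2 * t * c + t ^+ 2.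
    rewrite /D (distC p q) !sqr_dist ck.
    have -> : q + t *: k - p = (q - p) + t *: k by rewrite addrAC.
    move: (q - p) => w; rewrite !dotpE (dotpC k w) -(sqr_enorm k) k1; ring.
  rewrite -/L; have h : (t + c) ^+ 2 < s ^+ 2.
    rewrite -[ltLHS]real_normK ?num_real // (ltr_pXn2r (n := 2)) ?nnegrE // ltr_norml.
    by apply/andP; split; lra.
  have : (t + c) ^+ 2 = t ^+ 2 + 2 * t * c + c ^+ 2 by ring.
  lra.
have Bo := ball_q m a m1 m0 nm erefl sa1 sa2 erefl.
have aN : - a = dotp (q - p) (- m) by rewrite dotpNr.
have Bi : nearest S (q + (s - - a) *: - m) q.
  apply: (ball_q (- m) (- a)); rewrite ?enormN ?sqrrN //; try lra.
  - exact: oppn0.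
  - exact: oppn.
have ri0 : 0 < s + a by lra.
have ro0 : 0 < s - a by lra.
rewrite opprK scalerN in Bi.
have h1 := tangent_balls_disjoint Sp Sq Cpq onp onq n1 m1 L0 ri0 Bp Bi.
rewrite scalerN in Bp'.
have h2 := tangent_balls_disjoint Sq Sp Cqp onq onp m1 n1 ro0 L0 Bo Bp'.
have uE : dotp (p - q) m = - a by rewrite /a -dotpNl opprB.
split.
  (* [q] lies in neither of the two balls of radius [L] tangent at [p], which limits its height over
     the tangent plane. *)
  have sq k : enorm k = 1 -> nearest S (p + L *: k) p -> L ^+ 2 <= dotp (p + L *: k - q) (p + L *: k - q).
    move=> k1 [_ /(_ _ Sq)]; rewrite dist_ray k1 mulr1 gtr0_norm // -sqr_dist => h.
    by rewrite (ler_pXn2r (n := 2)) ?nnegrE ?dist_ge0 ?(ltW L0).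
  have := sq n n1 Bp; rewrite -scalerN in Bp'; have := sq (- n) (etrans (enormN n) n1) Bp'.
  have -> : p + L *: - n - q = (p - q) - L *: n by rewrite scalerN addrAC.
  have -> : p + L *: n - q = (p - q) + L *: n by rewrite addrAC.
  move: DE; rewrite /b; move: (p - q) => w DE; rewrite !dotpE (dotpC n w) -DE -(sqr_enorm n) n1.
  move=> h3 h4; rewrite ler_norml; apply/andP; split; lra.
exists (s + a), (s - a); split=> //.
- have -> : (s + a) * (s - a) = s ^+ 2 - a ^+ 2 by ring.
  by rewrite s2 addrC addKr.
(* With [ri = s + a], squaring the disjointness inequality leaves the term [- 2 * ri * a]. Since
   [ri ^+ 2 = L ^+ 2 - D ^+ 2 + 2 * ri * a], adding [ri ^+ 2] removes both [a] and [D]. *)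
- have p1 : 0 <= L + (s + a) by lra.
  move: h1; rewrite -(ler_pXn2r (n := 2)) ?nnegrE ?dist_ge0 //.
  rewrite sqr_dist.
  have -> : p + L *: n - (q - (s + a) *: m) = (p - q) + L *: n + (s + a) *: m.
    by apply/rowP => i; rewrite !mxE; ring.
  move: DE uE; rewrite /b; move: (p - q) => w DE uE.
  rewrite !dotpE (dotpC n w) (dotpC m w) (dotpC m n) uE -DE -(sqr_enorm n) -(sqr_enorm m) n1 m1.
  move=> h.
  have : (s + a) ^+ 2 = s ^+ 2 + 2 * s * a + a ^+ 2 by ring.
  lra.
- have p2 : 0 <= s - a + L by lra.
  move: h2; rewrite -(ler_pXn2r (n := 2)) ?nnegrE ?dist_ge0 //.
  rewrite sqr_dist.
  have -> : q + (s - a) *: m - (p - L *: n) = - ((p - q) - L *: n - (s - a) *: m).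
    by apply/rowP => i; rewrite !mxE; ring.
  move: DE uE; rewrite /b; move: (p - q) => w DE uE.
  rewrite !dotpE (dotpC n w) (dotpC m w) (dotpC m n) uE -DE -(sqr_enorm n) -(sqr_enorm m) n1 m1.
  move=> h.
  have : (s - a) ^+ 2 = s ^+ 2 - 2 * s * a + a ^+ 2 by ring.
  lra.
Qed.

End Geometry.

(** * Angle bounds *)

Section Angle.
Variable R : realType.
Implicit Types (x y z : R).

Lemma ler_acos x y : -1 <= x -> x <= y -> y <= 1 -> acos y <= acos x.
Proof.
move=> x1 xy y1.
have hx : -1 <= x <= 1 by rewrite x1 (le_trans xy).
have hy : -1 <= y <= 1 by rewrite y1 (le_trans x1).
have [ax cx] := acos_def hx; have [ay cy] := acos_def hy.
rewrite leNgt; apply/negP => lt; have : cos (acos y) < cos (acos x).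
  by rewrite ltr_cos // in_itv.
by rewrite cx cy ltNge xy.
Qed.

Lemma ltr_acos x y : -1 <= x -> x < y -> y <= 1 -> acos y < acos x.
Proof.
move=> x1 xy y1; rewrite lt_neqAle ler_acos ?(ltW xy) // andbT; apply/eqP => e.
have hx : -1 <= x <= 1 by rewrite x1 (le_trans (ltW xy)).
have hy : -1 <= y <= 1 by rewrite y1 (le_trans x1) // ltW.
by move: xy; rewrite -(acos_def hx).2 -(acos_def hy).2 e ltxx.
Qed.

(* Whichever of [ri], [ro] exceeds its value at the configuration where both
   constraints are tight, the corresponding constraint gives the bound. *)
Lemma two_ball_bound (k A B X E ri ro : R) : 0 <= X -> 0 < k -> 0 < ri -> 0 < ro ->
  0 <= E -> ri * ro = k -> E ^+ 2 = k * ((A + k) * (B + k)) ->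
  2 * ri * X + ri ^+ 2 <= A -> 2 * ro * X + ro ^+ 2 <= B ->
  2 * E * X <= A * B - k ^+ 2.
Proof.
move=> X0 k0 ri0 ro0 E0 rk E2 h1 h2.
have key (a b r : R) : 0 < r -> 0 < a + k -> 0 < b + k -> E ^+ 2 = k * ((a + k) * (b + k)) ->
    2 * r * X + r ^+ 2 <= a -> E <= r * (b + k) -> 2 * E * X <= a * b - k ^+ 2.
  move=> r0 a0 b0 e2 h hr.
  (* If both constraints are tight, eliminating [X] gives [(A + k) * ro = (B + k) * ri]; together
     with [ri * ro = k] this makes [t] the corresponding radius. *)
  pose t := E / (b + k).
  have tE : t * (b + k) = E by rewrite divfK // gt_eqF.
  have t0 : 0 <= t by rewrite divr_ge0 // ltW.
  have tr : t <= r by rewrite ler_pdivrMr.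
  have h' : 2 * t * X + t ^+ 2 <= a.
    apply: le_trans h; apply: lerD; last by rewrite lerXn2r ?nnegrE // ltW.
    by apply: ler_wpM2r => //; apply: ler_wpM2l.
  have t2 : t ^+ 2 * (b + k) = k * (a + k).
    apply: (@mulIf _ (b + k)); first by rewrite gt_eqF.
    have -> : t ^+ 2 * (b + k) * (b + k) = (t * (b + k)) ^+ 2 by ring.
    rewrite tE e2; ring.
  have := ler_wpM2r (ltW b0) h'.
  have -> : (2 * t * X + t ^+ 2) * (b + k) = 2 * (t * (b + k)) * X + t ^+ 2 * (b + k) by ring.
  by rewrite tE t2; lra.
have r2 : 0 < ri ^+ 2 by rewrite exprn_gt0.
have o2 : 0 < ro ^+ 2 by rewrite exprn_gt0.
have p1 : 0 <= 2 * ri * X by rewrite !mulr_ge0 // ltW.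
have p2 : 0 <= 2 * ro * X by rewrite !mulr_ge0 // ltW.
have A0 : 0 < A + k by lra.
have B0 : 0 < B + k by lra.
have [h|h] := leP E (ri * (B + k)); first exact: key h.
rewrite (mulrC A); apply: (key B A ro) => //; first by rewrite E2 (mulrC (A + k)).
have h3 : ri * ro * (B + k) < E * ro by rewrite mulrAC ltr_pM2r.
have E1 : 0 < E by apply: le_lt_trans h; rewrite mulr_ge0 ?ltW.
rewrite -(ler_pM2l E1) -expr2 E2; rewrite rk in h3.
have := ler_wpM2l (ltW A0) (ltW h3); lra.
Qed.

(** Here [k = 1 - delta ^+ 2], [A = 1 + 2 * beta] and [B = 1 - 2 * beta], so [(A + k) * (B + k)] is
    the second factor under the root and [A * B - k ^+ 2] is twice the numerator. *)
Lemma eta1N_bound (delta beta X ri ro : R) : 0 <= X -> 0 < 1 - delta ^+ 2 ->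
  0 < ri -> 0 < ro -> ri * ro = 1 - delta ^+ 2 ->
  2 * ri * X + ri ^+ 2 <= 1 + 2 * beta -> 2 * ro * X + ro ^+ 2 <= 1 - 2 * beta ->
  `|2 * beta| <= delta ^+ 2 ->
  X <= (delta ^+ 2 - delta ^+ 4 / 2 - 2 * beta ^+ 2) /
     Num.sqrt ((1 - delta ^+ 2) * ((2 - delta ^+ 2) ^+ 2 - 4 * beta ^+ 2)).
Proof.
move=> X0 k0 ri0 ro0 rk h1 h2; rewrite ler_norml => /andP[b1 b2].
set E2 := (1 - delta ^+ 2) * _.
have E20 : 0 < E2.
  rewrite mulr_gt0 // (_ : _ - _ = (2 - delta ^+ 2 - 2 * beta) * (2 - delta ^+ 2 + 2 * beta)); last by ring.
  by rewrite mulr_gt0 //; lra.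
have sE : Num.sqrt E2 ^+ 2 = E2 by rewrite sqr_sqrtr // ltW.
rewrite ler_pdivlMr ?sqrtr_gt0 //.
have := @two_ball_bound (1 - delta ^+ 2) (1 + 2 * beta) (1 - 2 * beta) X (Num.sqrt E2) ri ro X0 k0 ri0 ro0 (sqrtr_ge0 _) rk.
rewrite sE => /(_ _ h1 h2) h.
have {}h := h (_ : E2 = _).
have : 2 * Num.sqrt E2 * X <= (1 + 2 * beta) * (1 - 2 * beta) - (1 - delta ^+ 2) ^+ 2.
  by apply: h; rewrite /E2; ring.
have -> : (1 + 2 * beta) * (1 - 2 * beta) - (1 - delta ^+ 2) ^+ 2 =
  2 * (delta ^+ 2 - delta ^+ 4 / 2 - 2 * beta ^+ 2) by field.
by rewrite -mulrA ler_pM2l // mulrC.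
Qed.

(** Over a common denominator, the squared numerators differ by [beta ^+ 2 * (4 * D - 3 * D ^+ 2 - 4
    * beta ^+ 2)] with [D = delta ^+ 2]. By the bound on [beta] the last factor is at least
    [4 * D * (1 - D)]. *)
Lemma eta1N_arg_le (delta beta : R) : delta ^+ 2 < 1 -> `|2 * beta| <= delta ^+ 2 ->
  let Y := (delta ^+ 2 - delta ^+ 4 / 2 - 2 * beta ^+ 2) /
     Num.sqrt ((1 - delta ^+ 2) * ((2 - delta ^+ 2) ^+ 2 - 4 * beta ^+ 2)) in
  let Z := delta ^+ 2 / (2 * Num.sqrt (1 - delta ^+ 2)) in
  Y <= Z /\ (beta != 0 -> Y < Z).
Proof.
move=> dl1 hb Y Z.
have k0 : 0 < 1 - delta ^+ 2 by rewrite subr_gt0.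
pose D := delta ^+ 2; pose N := delta ^+ 2 - delta ^+ 4 / 2 - 2 * beta ^+ 2.
pose F := (2 - delta ^+ 2) ^+ 2 - 4 * beta ^+ 2.
have b2 : 4 * beta ^+ 2 <= D ^+ 2.
  have -> : 4 * beta ^+ 2 = `|2 * beta| ^+ 2 by rewrite real_normK ?num_real //; ring.
  by rewrite lerXn2r ?nnegrE ?sqr_ge0.
have D0 : 0 <= D by exact: sqr_ge0.
have D1 : D < 1 by [].
have FE : F = (2 - D) ^+ 2 - 4 * beta ^+ 2 by [].
have F0 : 0 < F by rewrite FE; nra.
have NE : N = D - D ^+ 2 / 2 - 2 * beta ^+ 2 by rewrite /N /D; ring.
have N0 : 0 <= N by rewrite NE; nra.
have YE : Y = N / (Num.sqrt (1 - delta ^+ 2) * Num.sqrt F) by rewrite /Y sqrtrM // ltW.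
have ZE : Z = (D / 2 * Num.sqrt F) / (Num.sqrt (1 - delta ^+ 2) * Num.sqrt F).
  by rewrite /Z /D; field; rewrite !gt_eqF ?sqrtr_gt0.
have den : 0 < (Num.sqrt (1 - delta ^+ 2) * Num.sqrt F)^-1.
  by rewrite invr_gt0 mulr_gt0 ?sqrtr_gt0.
have sF : Num.sqrt F ^+ 2 = F by rewrite sqr_sqrtr // ltW.
have R0 : 0 <= D / 2 * Num.sqrt F by rewrite mulr_ge0 ?sqrtr_ge0 // divr_ge0.
have b0 : 0 <= beta ^+ 2 by exact: sqr_ge0.
have sqE : (D / 2 * Num.sqrt F) ^+ 2 - N ^+ 2 = beta ^+ 2 * (4 * D - 3 * D ^+ 2 - 4 * beta ^+ 2).
  by rewrite exprMn sF FE NE; field.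
rewrite YE ZE ler_pM2r // ltr_pM2r //; split.
  rewrite -(ler_pXn2r (n := 2)) ?nnegrE // -subr_ge0 sqE mulr_ge0 //; nra.
move=> bn0; have b0' : 0 < beta ^+ 2 by rewrite exprn_even_gt0.
rewrite -(ltr_pXn2r (n := 2)) ?nnegrE // -subr_gt0 sqE mulr_gt0 //.
have Dp : 0 < D by nra.
nra.
Qed.

(** The threshold is where the argument of the arccosine in [eta1] reaches -1: with [D = delta ^+ 2]
    this reads [D ^+ 2 = 16 * (1 - D)], that is [(D + 8) ^+ 2 = 80]. *)
Lemma delta_bounds (delta : R) : 0 <= delta -> delta < Num.sqrt (4 * Num.sqrt 5 - 8) ->
  delta ^+ 2 < 1 /\ delta ^+ 2 / (2 * Num.sqrt (1 - delta ^+ 2)) <= 2.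
Proof.
move=> d0 hd; have s5 : Num.sqrt (5 : R) ^+ 2 = 5 by rewrite sqr_sqrtr.
have s0 : 0 <= Num.sqrt (5 : R) by exact: sqrtr_ge0.
have s9 : Num.sqrt (5 : R) < 9 / 4 by nra.
have s2 : 2 <= Num.sqrt (5 : R) by nra.
have dl2 : delta ^+ 2 < 4 * Num.sqrt 5 - 8.
  rewrite -(@sqr_sqrtr _ (4 * Num.sqrt 5 - 8)); last by lra.
  by rewrite (ltr_pXn2r (n := 2)) ?nnegrE ?sqrtr_ge0.
have D1 : delta ^+ 2 < 1 by lra.
split=> //; rewrite ler_pdivrMr ?mulr_gt0 ?sqrtr_gt0 ?subr_gt0 //.
set D := delta ^+ 2 in dl2 D1 *; have D0 : 0 <= D by exact: sqr_ge0.
clearbody D; rewrite -(ler_pXn2r (n := 2)) ?nnegrE ?mulr_ge0 ?sqrtr_ge0 //.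
rewrite !exprMn sqr_sqrtr ?subr_ge0 ?(ltW D1) //.
have : (D + 8) ^+ 2 <= (4 * Num.sqrt 5) ^+ 2.
  by rewrite (ler_pXn2r (n := 2)) ?nnegrE ?mulr_ge0 //; lra.
by rewrite exprMn s5; lra.
Qed.

End Angle.

(** * Taylor expansion *)

Section Expansion.
Variable R : realType.
Implicit Types (x y z : R).

Lemma poly_bounded (p : {poly R}) : exists C : R, forall z, 0 <= z <= 1 -> `|p.[z]| <= C.
Proof.
exists (\sum_(i < size p) `|p`_i|) => z /andP[z0 z1].
rewrite horner_coef; apply: le_trans (ler_norm_sum _ _ _) _.
apply: ler_sum => i _; rewrite normrM [`|z ^+ i|]ger0_norm ?exprn_ge0 //.
by rewrite ler_piMr ?normr_ge0 ?exprn_ile1.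
Qed.

(** The derivative of the degree 7 Taylor polynomial, in the variable [z = x ^+ 2]. *)
Definition eta1_deriv_approx z : R := 1 + 7 / 8 * z + 123 / 128 * z ^+ 2 + 1083 / 1024 * z ^+ 3.

(* The truncated expansions of [(2 - z)^2 + z Y] and [Y = P^2 (1 - z)^2], with P
   the cubic above, agree with [X^2 = 16 (1 - z) Y^2] up to order 4. *)
Lemma eta1_deriv_residual : exists p : {poly R}, forall z,
  let Y := eta1_deriv_approx z ^+ 2 * (1 - z) ^+ 2 in
  let X := (2 - z) ^+ 2 + z * Y in
  X ^+ 2 - 16 * (1 - z) * Y ^+ 2 = z ^+ 4 * p.[z].
Proof.
pose c1 : R := 7 / 8; pose c2 : R := 123 / 128; pose c3 : R := 1083 / 1024.
(* [Y3] and [X3] are the truncations of [Y] and [X] below degree 4; [r1], [rY] and [rX] are the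
   remainders of [P ^+ 2], [Y] and [X] divided by [z ^+ 4], and [r0] is that of the identity between
   the truncations. *)
pose r1 : {poly R} := (2 * c1 * c3 + c2 ^+ 2)%:P + (2 * c2 * c3)%:P * 'X + (c3 ^+ 2)%:P * 'X^2.
pose rY : {poly R} := (- (157 / 32))%:P + (243 / 64)%:P * 'X + (1 - 'X) ^+ 2 * r1.
pose Y3 : {poly R} := 1 + (- (1 / 4))%:P * 'X + (3 / 16)%:P * 'X^2 + (11 / 64)%:P * 'X^3.
pose X3 : {poly R} := 4%:P + (- 3)%:P * 'X + (3 / 4)%:P * 'X^2 + (3 / 16)%:P * 'X^3.
pose rX : {poly R} := (11 / 64)%:P + 'X * rY.
pose r0 : {poly R} := (17 / 4)%:P + (- (25 / 16))%:P * 'X + (19 / 32)%:P * 'X^2 + (121 / 256)%:P * 'X^3.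
exists (r0 + 2%:P * X3 * rX + 'X^4 * rX ^+ 2 - 16%:P * (1 - 'X) * (2%:P * Y3 * rY + 'X^4 * rY ^+ 2)).
move=> z Y X.
have r1E : r1.[z] = (2 * c1 * c3 + c2 ^+ 2) + 2 * c2 * c3 * z + c3 ^+ 2 * z ^+ 2.
  by rewrite /r1 !hornerE.
have rYE : rY.[z] = - (157 / 32) + 243 / 64 * z + (1 - z) ^+ 2 * r1.[z].
  by rewrite /rY !hornerE.
have rXE : rX.[z] = 11 / 64 + z * rY.[z] by rewrite /rX !hornerE.
have Y3E : Y3.[z] = 1 - z / 4 + 3 / 16 * z ^+ 2 + 11 / 64 * z ^+ 3.
  by rewrite /Y3 !hornerE; field.
have X3E : X3.[z] = 4 - 3 * z + 3 / 4 * z ^+ 2 + 3 / 16 * z ^+ 3.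
  by rewrite /X3 !hornerE; field.
have r0E : r0.[z] = 17 / 4 - 25 / 16 * z + 19 / 32 * z ^+ 2 + 121 / 256 * z ^+ 3.
  by rewrite /r0 !hornerE; field.
have e0 : X3.[z] ^+ 2 - 16 * (1 - z) * Y3.[z] ^+ 2 = z ^+ 4 * r0.[z].
  by rewrite X3E Y3E r0E; field.
have P2 : eta1_deriv_approx z ^+ 2 =
    1 + 7 / 4 * z + 43 / 16 * z ^+ 2 + 243 / 64 * z ^+ 3 + z ^+ 4 * r1.[z].
  have gen (a b c : R) : (1 + a * z + b * z ^+ 2 + c * z ^+ 3) ^+ 2 = 1 + 2 * a * z +
      (a ^+ 2 + 2 * b) * z ^+ 2 + (2 * c + 2 * (a * b)) * z ^+ 3 +
      z ^+ 4 * ((2 * a * c + b ^+ 2) + 2 * b * c * z + c ^+ 2 * z ^+ 2) by ring.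
  rewrite r1E /eta1_deriv_approx -/c1 -/c2 -/c3.
  have -> : 7 / 4 = 2 * c1 by rewrite /c1; field.
  have -> : 43 / 16 = c1 ^+ 2 + 2 * c2 by rewrite /c1 /c2; field.
  have -> : 243 / 64 = 2 * c3 + 2 * (c1 * c2) by rewrite /c1 /c2 /c3; field.
  exact: gen.
have eY : Y = Y3.[z] + z ^+ 4 * rY.[z].
  by rewrite /Y P2 rYE Y3E; field.
have eX : X = X3.[z] + z ^+ 4 * rX.[z].
  by rewrite /X eY rXE X3E Y3E; field.
rewrite eX eY; clear r1E rYE rXE Y3E X3E r0E P2 eX eY X Y.
clearbody r0 X3 rX Y3 rY.
rewrite !(hornerD, hornerM, hornerN, hornerC, hornerX, hornerXn, horner_exp).
rewrite mulrBr !mulrDr -e0; ring.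
Qed.

Lemma is_derive_monomial (c : R) n x :
  is_derive x 1 (fun y : R => c * y ^+ n) (c * (n%:R * x ^+ n.-1)).
Proof.
have -> : (fun y : R => c * y ^+ n) = c \*: ((id : R -> R) ^+ n).
  by apply/funext => y; rewrite /= exprfctE.
have h := is_deriveZ c (is_deriveX n (is_derive_id x (1 : R))).
apply: (is_derive_eq h).
by rewrite /= [_ *: 1]mulr1.
Qed.

Definition eta1_taylor x : R :=
  x + 7 / 24 * x ^+ 3 + 123 / 640 * x ^+ 5 + 1083 / 7168 * x ^+ 7.

Lemma eta1_taylor_derive x : is_derive x 1 eta1_taylor (eta1_deriv_approx (x ^+ 2)).
Proof.
have h := is_deriveD (is_deriveD (is_deriveD (is_derive_id x (1 : R))
  (is_derive_monomial (7 / 24) 3 x)) (is_derive_monomial (123 / 640) 5 x))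
  (is_derive_monomial (1083 / 7168) 7 x).
apply: (is_derive_eq h).
have e : (7168 : R) = 7 * 1024 by rewrite -natrM; congr (_%:R).
have e0 : (1024 : R) != 0 by rewrite pnatr_eq0.
rewrite /eta1_deriv_approx /= e; move: (1024 : R) e0 => k k0; field.
by rewrite k0.
Qed.

(** With [w = z / (2 * s)], [1 - (1 - w) ^+ 2 = w * (2 - w) = z * (4 * s - z) / (2 * s) ^+ 2],
    whence the nested root. The range of [x] keeps [1 - w] strictly between -1 and 1, where the
    arccosine is differentiable. *)
Lemma eta1_derive x : 0 < x -> x < 1 / 2 -> is_derive x 1 (@eta1 R)
  ((2 - x ^+ 2) / ((1 - x ^+ 2) * Num.sqrt (4 * Num.sqrt (1 - x ^+ 2) - x ^+ 2))).
Proof.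
move=> x0 x1; set z := x ^+ 2; set s := Num.sqrt (1 - z).
have z0 : 0 < z by rewrite exprn_gt0.
have z1 : z < 1 / 4 by rewrite /z; nra.
have s2 : s ^+ 2 = 1 - z by rewrite sqr_sqrtr //; lra.
have s0 : 0 < s by rewrite sqrtr_gt0; lra.
have s34 : 3 / 4 <= s by nra.
have dq : is_derive x 1 (fun y : R => 1 + -1 * y ^+ 2) (0 + -1 * (2 * x ^+ 1)).
  have h := is_deriveD (is_derive_cst (1 : R) x (1 : R)) (is_derive_monomial (-1) 2 x).
  exact: (is_derive_eq h).
have qx : 1 + -1 * x ^+ 2 = 1 - z by rewrite mulN1r.
have ds : is_derive x 1 (fun y : R => Num.sqrt (1 + -1 * y ^+ 2))
    ((2 * s)^-1 * (0 + -1 * (2 * x ^+ 1))).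
  apply: (@is_derive1_comp R Num.sqrt _ x) dq.
  by rewrite /s -qx; apply: is_derive1_sqrt; rewrite qx; lra.
have dV : is_derive x 1 (fun y : R => (Num.sqrt (1 + -1 * y ^+ 2))^-1)
    (- s ^- 2 *: ((2 * s)^-1 * (0 + -1 * (2 * x ^+ 1)))).
  rewrite /s -qx; apply: is_deriveV; rewrite ?qx -/s ?gt_eqF //.
have dh := is_deriveD (is_derive_cst (1 : R) x (1 : R))
  (is_deriveM (is_derive_monomial (- (1 / 2)) 2 x) dV).
pose w := z / (2 * s).
have wb : 0 < w < 2.
  rewrite divr_gt0 ?mulr_gt0 //= ltr_pdivrMr ?mulr_gt0 //; lra.
have eta1E : @eta1 R = (@acos R) \o (cst 1 + (fun y : R => - (1 / 2) * y ^+ 2) *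
    (fun y : R => (Num.sqrt (1 + -1 * y ^+ 2))^-1)).
  apply/funext => y; rewrite /eta1 /=; congr acos.
  transitivity (1 + - (1 / 2) * y ^+ 2 * (Num.sqrt (1 + -1 * y ^+ 2))^-1); last by [].
  rewrite mulN1r invfM; move: (Num.sqrt (1 - y ^+ 2))^-1 => i; by field.
have hx : 1 + - (1 / 2) * x ^+ 2 * (Num.sqrt (1 + -1 * x ^+ 2))^-1 = 1 - w.
  by rewrite qx -/s -/z /w; field; rewrite gt_eqF.
have hw1 : -1 < 1 - w < 1 by case/andP: wb => *; apply/andP; split; lra.
have dac : is_derive (1 + - (1 / 2) * x ^+ 2 * (Num.sqrt (1 + -1 * x ^+ 2))^-1) 1 (@acos R)
   (- (Num.sqrt (1 - (1 - w) ^+ 2))^-1).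
  by rewrite hx; exact: is_derive1_acos.
have h := @is_derive1_comp R _ _ x _ _ dac dh.
rewrite eta1E; apply: (is_derive_eq h) => {h dac dh eta1E}.
set t := Num.sqrt (4 * s - z).
have t0 : 0 < t by rewrite sqrtr_gt0; lra.
have t2 : t ^+ 2 = 4 * s - z by rewrite sqr_sqrtr //; lra.
have -> : Num.sqrt (1 - (1 - w) ^+ 2) = x * t / (2 * s).
  rewrite -[RHS]ger0_norm ?divr_ge0 ?mulr_ge0 ?ltW // -sqrtr_sqr; congr Num.sqrt.
  rewrite expr_div_n exprMn t2 /w -/z; field; rewrite gt_eqF //.
have sc (a b : R) : a *: b = a * b by [].
have n2 : 2 - z = 2 * s ^+ 2 + x ^+ 2 by rewrite s2 -/z; ring.
rewrite qx -/s !sc n2 -s2 /= expr1; clearbody s t; clear -x0 s0 t0.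
by field; rewrite !gt_eqF.
Qed.

Lemma eta1_deriv_approx_ge1 z : 0 <= z -> 1 <= eta1_deriv_approx z.
Proof.
move=> z0; have c0 (a b : nat) n : 0 <= (a%:R / b%:R : R) * z ^+ n.
  by apply: mulr_ge0; [apply: divr_ge0; exact: ler0n | exact: exprn_ge0].
have h1 := c0 7 8 1; have h2 := c0 123 128 2; have h3 := c0 1083 1024 3.
rewrite /eta1_deriv_approx -!addrA lerDl.
rewrite expr1 in h1; exact: addr_ge0 h1 (addr_ge0 h2 h3).
Qed.

(** For the true derivative [A] in place of [P], clearing denominators gives [X = 4 * s * Y], and
    squaring gives the identity whose residual is known to be of order [z ^+ 4]. Going back from the
    residual to [X - 4 * s * Y] and then to [A - P] divides by factors that are at least 1. *)
Lemma eta1_deriv_error : exists2 C : R, 0 < C & forall x, 0 < x -> x < 1 / 2 ->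
  `|(2 - x ^+ 2) / ((1 - x ^+ 2) * Num.sqrt (4 * Num.sqrt (1 - x ^+ 2) - x ^+ 2))
    - eta1_deriv_approx (x ^+ 2)| <= C * x ^+ 8.
Proof.
have [p hp] := eta1_deriv_residual; have [C hC] := poly_bounded p.
exists (`|C| + 1); first by rewrite ltr_wpDl.
move=> x x0 x1; set z := x ^+ 2; set s := Num.sqrt (1 - z).
have z0 : 0 < z by rewrite exprn_gt0.
have z1 : z < 1 / 4 by rewrite /z; nra.
have -> : x ^+ 8 = z ^+ 4 by rewrite -exprM.
have s2 : s ^+ 2 = 1 - z by rewrite sqr_sqrtr //; lra.
have s0 : 0 < s by rewrite sqrtr_gt0; lra.
have s34 : 3 / 4 <= s by nra.
set t := Num.sqrt (4 * s - z).
have t0 : 0 < t by rewrite sqrtr_gt0; lra.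
have t2 : t ^+ 2 = 4 * s - z by rewrite sqr_sqrtr //; lra.
have /= := hp z; set P := eta1_deriv_approx z.
have P1 : 1 <= P by apply: eta1_deriv_approx_ge1; exact: ltW.
set A := _ / _; clearbody s t P; move=> hres.
have A0 : 0 <= A by rewrite divr_ge0 ?mulr_ge0 ?(ltW t0) //; lra.
have hz4 : 0 <= z ^+ 4 by rewrite exprn_ge0 // ltW.
have hpz : `|z ^+ 4 * p.[z]| <= (`|C| + 1) * z ^+ 4.
  rewrite normrM (ger0_norm hz4) mulrC ler_wpM2r //.
  have := hC z; have := ler_norm C; have h01 : 0 <= z <= 1 by apply/andP; split; lra.
  by move=> ? /(_ h01) ?; lra.
pose Y := P ^+ 2 * (1 - z) ^+ 2; pose X := (2 - z) ^+ 2 + z * Y.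
have Y0 : 0 <= Y by rewrite mulr_ge0 ?sqr_ge0.
have X1 : 1 <= X.
  have : 0 <= z * Y by rewrite mulr_ge0 // ltW.
  rewrite /X; nra.
have XY : `|X - 4 * s * Y| <= (`|C| + 1) * z ^+ 4.
  apply: le_trans hpz; rewrite -hres.
  have -> : ((2 - z) ^+ 2 + z * (P ^+ 2 * (1 - z) ^+ 2)) ^+ 2 - 16 * (1 - z) * (P ^+ 2 * (1 - z) ^+ 2) ^+ 2 =
     (X - 4 * s * Y) * (X + 4 * s * Y) by rewrite /X /Y -s2; ring.
  have sY : 0 <= 4 * s * Y by rewrite mulr_ge0 // mulr_ge0 // ltW.
  by rewrite normrM ler_peMr // (le_trans _ (ler_norm _)) //; lra.
have D1 : 1 <= (1 - z) ^+ 2 * t ^+ 2 by rewrite t2; nra.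
have AE : A ^+ 2 * ((1 - z) ^+ 2 * t ^+ 2) = (2 - z) ^+ 2.
  rewrite /A; field; rewrite !gt_eqF //; lra.
apply: le_trans XY.
have -> : X - 4 * s * Y = (A - P) * ((A + P) * ((1 - z) ^+ 2 * t ^+ 2)).
  rewrite /X -AE /Y; have -> : 4 * s = t ^+ 2 + z by rewrite t2; ring.
  ring.
rewrite normrM ler_peMr // (le_trans _ (ler_norm _)) //.
rewrite -[1]mulr1; apply: ler_pM => //; lra.
Qed.

Lemma eta1_0 : eta1 (0 : R) = 0.
Proof. by rewrite /eta1 expr0n /= mul0r subr0 acos1. Qed.

(** At 0 the arccosine is taken at the end of its domain, where [eta1_derive] is silent; the mean
    value theorem on [[0, x]] still needs continuity there, obtained from the monotonicity of the
    cosine. *)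
Lemma eta1_continuous0 : {for 0, continuous (@eta1 R)}.
Proof.
have small (e : R) : 0 < e -> \forall y \near nbhs (0 : R), `|eta1 0 - eta1 y| < e.
  move=> e0; pose e' := Num.min e 1.
  have e'0 : 0 < e' by rewrite lt_min e0 ltr01.
  have e'1 : e' <= 1 by rewrite ge_min lexx orbT.
  have ppi := pi_ge2 R.
  have c1 : cos e' < 1.
    by rewrite -cos0 ltr_cos ?in_itv /= ?lexx //; apply/andP; split; lra.
  pose r := Num.min (1 / 2) (1 - cos e').
  have r0 : 0 < r by rewrite lt_min subr_gt0 c1 andbT; lra.
  apply/nbhs_ballP; exists r => // y; rewrite -ball_normE /ball_ /= sub0r normrN.
  rewrite lt_min => /andP[y1 y2]; rewrite eta1_0 sub0r normrN.
  have y3 : y ^+ 2 <= `|y| / 2.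
    rewrite -[leLHS]real_normK ?num_real // expr2 ler_wpM2l //; lra.
  have y0 : 0 <= y ^+ 2 by exact: sqr_ge0.
  have s0 : 0 <= Num.sqrt (1 - y ^+ 2) by exact: sqrtr_ge0.
  have s2 : Num.sqrt (1 - y ^+ 2) ^+ 2 = 1 - y ^+ 2 by rewrite sqr_sqrtr //; lra.
  have s1 : 1 / 2 <= Num.sqrt (1 - y ^+ 2) by nra.
  have w0 : 0 <= y ^+ 2 / (2 * Num.sqrt (1 - y ^+ 2)) by rewrite divr_ge0 // mulr_ge0.
  have w1 : y ^+ 2 / (2 * Num.sqrt (1 - y ^+ 2)) <= y ^+ 2.
    by rewrite ler_pdivrMr ?mulr_gt0 //; [nra | lra].
  rewrite /eta1; set w := _ / _ in w0 w1 *.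
  have wb : -1 <= 1 - w <= 1 by have := normr_ge0 y => *; apply/andP; split; lra.
  have [ab cw] := acos_def wb; case/andP: (ab) => a0 _.
  rewrite ger0_norm //; apply: (@lt_le_trans _ _ e'); last by rewrite ge_min lexx.
  rewrite -ltr_cos ?in_itv //=; last by apply/andP; split; lra.
  by rewrite cw; have := normr_ge0 y; lra.
by move: small => /(@cvgrPdist_lt _ _ _ (nbhs (0 : R))).
Qed.

(** The error vanishes at 0 and its derivative is of order 8, so the mean value theorem gives order
    9. *)
Lemma eta1_expansion :
  (fun x : R => eta1 x - (x + 7 / 24 * x ^+ 3 + 123 / 640 * x ^+ 5
                          + 1083 / 7168 * x ^+ 7))
    =O_ ((0 : R)^'+) (fun x : R => x ^+ 9).
Proof.
have [C C0 hC] := eta1_deriv_error.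
apply/eqO_exP; exists C => //.
have h0 : \forall x \near (0 : R)^'+, 0 < x by exact: nbhs_right_gt.
have h1 : \forall x \near (0 : R)^'+, x < 1 / 2 by apply: nbhs_right_lt; lra.
apply: filterS2 h0 h1 => x x0 x1; rewrite -/(eta1_taylor x).
pose E y : R := (2 - y ^+ 2) / ((1 - y ^+ 2) * Num.sqrt (4 * Num.sqrt (1 - y ^+ 2) - y ^+ 2)).
pose f y := eta1 y - eta1_taylor y.
have df y : 0 < y -> y < 1 / 2 -> is_derive y 1 f (E y - eta1_deriv_approx (y ^+ 2)).
  move=> y0 y1; exact: is_deriveB (eta1_derive y0 y1) (eta1_taylor_derive y).
have dfo y : y \in `]0, x[ -> is_derive y 1 f (E y - eta1_deriv_approx (y ^+ 2)).
  by rewrite in_itv /= => /andP[y0 yx]; apply: df => //; exact: lt_trans yx x1.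
have cf : {within `[0, x], continuous f}.
  apply: continuous_in_subspaceT => y; rewrite inE /= in_itv /= => /andP[y0 yx].
  have [y00|yn0] := eqVneq y 0.
    rewrite y00; have ct : {for 0, continuous eta1_taylor}.
      apply/differentiable_continuous/derivable1_diffP.
      by case: (eta1_taylor_derive 0).
    exact: cvgB eta1_continuous0 ct.
  apply/differentiable_continuous/derivable1_diffP.
  have yp : 0 < y by rewrite lt_neqAle eq_sym yn0.
  by case: (df y yp (le_lt_trans yx x1)).
have [c] := MVT x0 dfo cf; rewrite in_itv /= => /andP[c0 cx].
have f0 : f 0 = 0.
  by rewrite /f eta1_0 /eta1_taylor !expr0n /= !mulr0 !addr0 subrr.
rewrite f0 !subr0 -/(f x) => ->; rewrite normrM (gtr0_norm x0).
rewrite (ger0_norm (exprn_ge0 9 (ltW x0))) [x ^+ 9]exprSr mulrA; apply: ler_wpM2r; first exact: ltW.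
apply: le_trans (hC c c0 (lt_trans cx x1)) _.
by rewrite ler_wpM2l ?(ltW C0) // lerXn2r ?nnegrE ?ltW.
Qed.

End Expansion.

(** * Rescaling to unit normals and unit local feature size *)

Lemma outward_normalZ (R : realType) d (S : set 'rV[R]_d) p n (c : R) : 0 < c ->
  outward_normal S p n -> outward_normal S p (c *: n).
Proof.
move=> c0 [n0 nn on]; split.
- by rewrite scaler_eq0 negb_or n0 gt_eqF.
- by move=> v /nn; rewrite dotpZl => ->; rewrite mulr0.
have /nbhs_ballP[e /= e0 he] := on.
apply/nbhs_ballP; exists (e / c); first by rewrite /= divr_gt0.
move=> t; rewrite -ball_normE /ball_ /= sub0r normrN => te t0.
rewrite scalerA; apply: he; last by rewrite /= mulr_gt0.
by rewrite -ball_normE /ball_ /= sub0r normrN normrM (gtr0_norm c0) -ltr_pdivlMr.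
Qed.

Theorem lemma5 (R : realType) :
  (forall (d : nat) (Sigma : set 'rV[R]_d) (p q np nq : 'rV[R]_d),
     (2 <= d)%N ->
     compact Sigma ->
     submanifold d.-1 Sigma ->
     Sigma p -> Sigma q ->
     outward_normal Sigma p np ->
     outward_normal Sigma q nq ->
     let delta := dist p q / lfs Sigma p in
     let deltaN := distset q (tangent_space Sigma p) / lfs Sigma p in
     delta < Num.sqrt (4 * Num.sqrt 5 - 8) ->
     [/\ angle np nq <= eta1 delta,
         angle np nq <= eta1N delta deltaN &
         deltaN != 0 -> eta1N delta deltaN < eta1 delta]) /\
  (fun x : R => eta1 x - (x + 7 / 24 * x ^+ 3 + 123 / 640 * x ^+ 5
                          + 1083 / 7168 * x ^+ 7))
    =O_ ((0 : R)^'+) (fun x : R => x ^+ 9).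
Proof.
split; last exact: eta1_expansion.
move=> [|d] Sigma p q np nq // d2 cS mS Sp Sq onp onq delta deltaN hdelta.
have d1 : (1 <= d)%N by [].
rewrite /= in mS.
have np0 : 0 < enorm np by case: onp => n0 _ _; rewrite enorm_gt0.
have nq0 : 0 < enorm nq by case: onq => n0 _ _; rewrite enorm_gt0.
pose n := (enorm np)^-1 *: np; pose m := (enorm nq)^-1 *: nq.
have onn : outward_normal Sigma p n by apply: outward_normalZ; rewrite ?invr_gt0.
have onm : outward_normal Sigma q m by apply: outward_normalZ; rewrite ?invr_gt0.
have n1 : enorm n = 1 by rewrite enormZ gtr0_norm ?invr_gt0 // mulVf ?gt_eqF.
have m1 : enorm m = 1 by rewrite enormZ gtr0_norm ?invr_gt0 // mulVf ?gt_eqF.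
have angleE : angle np nq = acos (1 - (1 - dotp n m)).
  rewrite /angle subKr; congr acos; rewrite /n /m dotpZl dotpZr invfM; ring.
have L0 : 0 < lfs Sigma p := lfs_gt0 mS cS d1 Sp onn.
have dl0 : 0 <= delta by rewrite divr_ge0 ?dist_ge0 // ltW.
have [dl1 hZ] := delta_bounds dl0 hdelta.
have DL : dist p q = delta * lfs Sigma p by rewrite /delta divfK // gt_eqF.
have pq : dist p q < lfs Sigma p.
  rewrite DL gtr_pMl //; nra.
have [hb [ri [ro [ri0 ro0 rr h1 h2]]]] := normal_variation mS cS d1 Sp Sq onn onm n1 m1 pq.
have nn : normal_at Sigma p n by case: onn.
have dNE : distset q (tangent_space Sigma p) = `|dotp (p - q) n|.
  by rewrite (distset_tangent_space mS q Sp n1 nn) -opprB dotpNl normrN.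
have {}dNE : deltaN = `|dotp (p - q) n| / lfs Sigma p by rewrite /deltaN dNE.
clearbody delta deltaN; clear pq.
move: (lfs Sigma p) (dotp (p - q) n) dNE L0 DL hb rr h1 h2 => L b dNE L0 DL hb rr h1 h2.
have L20 : 0 < L ^+ 2 by rewrite exprn_gt0.
(* [beta] is [deltaN] up to sign; the final bounds involve only its square. *)
pose beta := b / L; have bE : b = beta * L by rewrite divfK // gt_eqF.
have dN2 : deltaN ^+ 2 = beta ^+ 2.
  by rewrite dNE -[X in _ / X](gtr0_norm L0) -normf_div real_normK ?num_real.
have X0 : 0 <= 1 - dotp n m.
  by have := dotp_le_enorm n m; rewrite n1 m1 mulr1 subr_ge0.
have hb' : `|2 * beta| <= delta ^+ 2.
  rewrite -(ler_pM2r L20) -exprMn -DL; apply: le_trans hb.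
  rewrite bE -[X in _ * X](gtr0_norm L20) -normrM le_eqVlt; apply/orP; left; apply/eqP.
  congr (`|_|); ring.
move: (1 - dotp n m) angleE X0 h1 h2 => X angleE X0 h1 h2.
pose r := ri / L; have rE : ri = r * L by rewrite divfK // gt_eqF.
pose s := ro / L; have sE : ro = s * L by rewrite divfK // gt_eqF.
have XY : X <= (delta ^+ 2 - delta ^+ 4 / 2 - 2 * beta ^+ 2) /
     Num.sqrt ((1 - delta ^+ 2) * ((2 - delta ^+ 2) ^+ 2 - 4 * beta ^+ 2)).
  apply: (@eta1N_bound R delta beta X r s) => //; rewrite ?subr_gt0 ?divr_gt0 //.
  - apply: (@mulIf _ (L ^+ 2)); first by rewrite gt_eqF.
    rewrite mulrBl mul1r -exprMn -DL -rr rE sE; ring.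
  - rewrite -(ler_pM2r L20); have -> : (2 * r * X + r ^+ 2) * L ^+ 2 = 2 * L * ri * X + ri ^+ 2 by rewrite rE; ring.
    apply: le_trans h1 _; rewrite bE le_eqVlt; apply/orP; left; apply/eqP; ring.
  - rewrite -(ler_pM2r L20); have -> : (2 * s * X + s ^+ 2) * L ^+ 2 = 2 * L * ro * X + ro ^+ 2 by rewrite sE; ring.
    apply: le_trans h2 _; rewrite bE le_eqVlt; apply/orP; left; apply/eqP; ring.
have [YZ YZlt] := eta1N_arg_le dl1 hb'.
have dN0 : deltaN != 0 -> beta != 0.
  by apply: contra => /eqP b0; rewrite -sqrf_eq0 dN2 b0 expr0n.
rewrite angleE /eta1N /eta1 dN2.
(* The chain [0 <= X <= Y <= Z <= 2] keeps [1 - X], [1 - Y] and [1 - Z] in the interval from -1 to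
   1, where the arccosine decreases. *)
move: (_ / Num.sqrt _) (_ / (2 * _)) XY hZ YZ YZlt => Y Z XY hZ YZ YZlt.
split.
- by apply: ler_acos; lra.
- by apply: ler_acos; lra.
- by move=> /dN0/YZlt lt; apply: ltr_acos; lra.
Qed.
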